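(* Let $\Omega\subset\mathbb{R}^n$ be a bounded domain and assume that $(\Omega,k_\Omega)$ is Gromov hyperbolic. Then the following are equivalent: (1) $\Omega$ is a QH-visibility domain. (2) The identity map $id:(\Omega,k_\Omega)\to(\Omega,d_{Euc})$ extends as a continuous surjective map $\Phi:\overline{\Omega}^G\to\overline{\Omega}^{Euc}$.
   Context: For a domain $\Omega\subsetneq\mathbb{R}^n$, $\partial_{Euc}\Omega$ and $\overline{\Omega}^{Euc}$ are its Euclidean boundary and closure, $d_{Euc}$ is the Euclidean distance and $\delta_\Omega(x)=d_{Euc}(x,\partial_{Euc}\Omega)$. The quasihyperbolic metric is $k_\Omega(x,y)=\inf_\gamma\int_\gamma\frac{|dx|}{\delta_\Omega(x)}$, the infimum over rectifiable curves in $\Omega$ joining $x$ and $y$; $(\Omega,k_\Omega)$ is a complete, proper, geodesic metric space, and a quasihyperbolic geodesic is a geodesic of $(\Omega,k_\Omega)$. When $(\Omega,k_\Omega)$ is Gromov hyperbolic (geodesic triangles are $\delta$-thin for some $\delta\ge0$), $\partial_G\Omega$ denotes its Gromov boundary (equivalence classes of geodesic rays from a base point, two rays $\gamma,\sigma$ being equivalent if $\sup_{t\ge0}k_\Omega(\gamma(t),\sigma(t))<\infty$), and $\overline{\Omega}^G=\Omega\cup\partial_G\Omega$ is the Gromov compactification with its usual topology. A bounded domain $\Omega$ is a QH-visibility domain if for every pair $p,q\in\partial_{Euc}\Omega$, $p\neq q$, there exist neighborhoods $U$ of $p$ and $V$ of $q$ in $\mathbb{R}^n$ with $\overline U\cap\overline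 V=\emptyset$ and a compact set $K\subset\Omega$ such that every quasihyperbolic geodesic $\gamma:[0,T]\to\Omega$ with $\gamma(0)\in U$ and $\gamma(T)\in V$ satisfies $\gamma([0,T])\cap K\neq\emptyset$. *)

(* Defs.v *)
(* MathComp-Analysis; R^n is 'rV[R]_n.  The library's norm on 'rV[R]_n is the
   sup norm: it is used only through the notions open, closed, compact,
   connected, continuous and bounded, which agree with the Euclidean ones.
   Every metric quantity below uses the Euclidean distance [edist]. *)
From HB Require Import structures.
#[warnings="-all"] From mathcomp Require Import all_boot all_order all_algebra.
#[warnings="-all"] From mathcomp Require Import all_classical all_reals all_analysis.

Set Implicit Arguments.
Unset Strict Implicit.
Unset Printing Implicit Defensive.

Import Order.TTheory GRing.Theory Num.Theory.
Import numFieldNormedType.Exports.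

Local Open Scope classical_set_scope.
Local Open Scope ring_scope.

Section EuclideanSpace.
Context {R : realType} {n : nat}.
Implicit Types (x y : 'rV[R]_n) (A Omega : set 'rV[R]_n) (g : R -> 'rV[R]_n).

Definition edist x y : R := Num.sqrt (\sum_(i < n) (x 0 i - y 0 i) ^+ 2).

Definition boundary A : set 'rV[R]_n := closure A `\` interior A.

Definition domain Omega : Prop :=
  [/\ open Omega, connected Omega, Omega !=set0 & Omega <> setT].

Definition bdist Omega x : R := inf [set edist x y | y in boundary Omega].

Definition curve_variation (a b : R) g (s : seq R) : R :=
  let F := g \o nth b (a :: s) in
  \sum_(0 <= i < size s) edist (F i.+1) (F i).

Definition curve_length (a b : R) g : \bar R :=
  ereal_sup [set (curve_variation a b g s)%:E | s in itv_partition a b].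

Definition rectifiable (a b : R) g : Prop := (curve_length a b g < +oo)%E.

(* The point at length [s] from the start of g : [a, b] -> R^n.  The chosen
   parameter is irrelevant, since g is constant on each set of parameters
   where the length from [a] takes a given finite value. *)
Definition arclength_param (a b : R) g (s : R) : 'rV[R]_n :=
  g (xget a [set t | t \in `[a, b] /\ curve_length a t g = s%:E]).

(* The integral of rho with respect to |dx| along a rectifiable curve. *)
Definition line_integral (rho : 'rV[R]_n -> R) (a b : R) g : \bar R :=
  (\int[@lebesgue_measure R]_(s in `[0%R, fine (curve_length a b g)])
      (rho (arclength_param a b g s))%:E)%E.

Definition rectifiable_curve_in Omega x y (a b : R) g : Prop :=
  [/\ a <= b, {within `[a, b], continuous g}, rectifiable a b g,
      (forall t, t \in `[a, b] -> Omega (g t)) & g a = x /\ g b = y].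

(* The infimum is a nonnegative real number for x, y in a domain. *)
Definition qh_dist Omega x y : R :=
  fine (ereal_inf [set l | exists a b g,
    rectifiable_curve_in Omega x y a b g /\
    l = line_integral (fun z => (bdist Omega z)^-1) a b g]).

End EuclideanSpace.

Section Gromov.
Context {R : realType} {V : Type}.
(* The metric space is (X, d), with X a subset of V; d is only used on X. *)
Variables (X : set V) (d : V -> V -> R).
Implicit Types (g h : R -> V) (x y o : V) (T : R).

Definition geodesic T g : Prop :=
  [/\ 0 <= T, (forall t, 0 <= t <= T -> X (g t)) &
      forall s t, 0 <= s <= T -> 0 <= t <= T -> d (g s) (g t) = `|s - t|].

Definition geodesic_from_to x y T g : Prop :=
  [/\ geodesic T g, g 0 = x & g T = y].

(* It suffices to constrain the first side, as the vertices x, y, z can be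
   permuted cyclically. *)
Definition thin_triangles (delta : R) : Prop :=
  forall x y z T1 T2 T3 g1 g2 g3,
    geodesic_from_to x y T1 g1 ->
    geodesic_from_to y z T2 g2 ->
    geodesic_from_to z x T3 g3 ->
    forall p, (g1 @` `[0, T1]) p ->
    exists q, (g2 @` `[0, T2] `|` g3 @` `[0, T3]) q /\ d p q <= delta.

Definition gromov_hyperbolic : Prop :=
  exists delta : R, 0 <= delta /\ thin_triangles delta.

(* Rays are represented by functions on R of which only the restriction to
   [0, +oo[ matters. *)
Definition geodesic_ray o g : Prop :=
  [/\ g 0 = o, (forall t, 0 <= t -> X (g t)) &
      forall s t, 0 <= s -> 0 <= t -> d (g s) (g t) = `|s - t|].

Definition equivalent_rays g h : Prop :=
  has_ubound [set d (g t) (h t) | t in [set t | 0 <= t]].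

Definition ray_class o g : set (R -> V) :=
  [set h | geodesic_ray o h /\ equivalent_rays g h].

Definition gromov_boundary o : Type :=
  {C : set (R -> V) | exists2 g, geodesic_ray o g & C = ray_class o g}.

Inductive gromov_closure o : Type :=
| Inner of {x : V | X x}
| Ideal of gromov_boundary o.

(* Generalized rays from o: geodesic segments, extended by a constant, and
   geodesic rays. *)
Definition generalized_ray o (p : gromov_closure o) g : Prop :=
  match p with
  | Inner x => exists T, geodesic_from_to o (sval x) T g /\
                         forall t, T <= t -> g t = sval x
  | Ideal C => sval C g
  end.

Definition cvg_on_compacts (c : nat -> R -> V) g : Prop :=
  forall T (e : R), 0 < e -> exists N, forall m, (N <= m)%N ->
    forall t, 0 <= t <= T -> d (c m t) (g t) < e.

Definition strictly_increasing (phi : nat -> nat) : Prop :=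
  {homo phi : i j / (i < j)%N}.

(* The usual topology of the compactification (Bridson-Haefliger, III.H.3.5):
   closed sets are those closed under the following convergence. *)
Definition gromov_cvg o (u : nat -> gromov_closure o) (l : gromov_closure o) :=
  exists2 c : nat -> R -> V, (forall m, generalized_ray (u m) (c m)) &
  forall phi, strictly_increasing phi ->
  exists2 psi, strictly_increasing psi &
  exists2 g, generalized_ray l g & cvg_on_compacts (c \o phi \o psi) g.

Definition gromov_closed o (C : set (gromov_closure o)) : Prop :=
  forall u l, (forall m, C (u m)) -> gromov_cvg u l -> C l.

Definition gromov_open o (U : set (gromov_closure o)) : Prop :=
  gromov_closed (~` U).

Lemma gromov_openT o : gromov_open (@setT (gromov_closure o)).
Proof. by move=> u l /(_ 0%N) /(_ I). Qed.

Lemma gromov_cvg_subseq o (u : nat -> gromov_closure o) l phi :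
  strictly_increasing phi -> gromov_cvg u l -> gromov_cvg (u \o phi) l.
Proof.
move=> phiS [c cu cP]; exists (c \o phi) => [m|psi psiS]; first exact: cu.
by apply: (cP (phi \o psi)) => i j ij; exact/phiS/psiS.
Qed.

Lemma frequently_subseq (P : nat -> Prop) :
  (forall N, exists2 m, (N <= m)%N & P m) ->
  exists2 phi, strictly_increasing phi & forall i, P (phi i).
Proof.
move=> PF.
have /choice[f fP] N : exists m, (N <= m)%N /\ P m.
  by have [m Nm Pm] := PF N; exists m.
pose phi := fix phi i := if i is j.+1 then f (phi j).+1 else f 0%N.
exists phi; last by case=> [|i]; exact: (fP _).2.
have phiS i : (phi i < phi i.+1)%N by exact: (fP _).1.
exact: (homo_ltn ltn_trans phiS).
Qed.

Lemma gromov_openI o (A B : set (gromov_closure o)) :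
  gromov_open A -> gromov_open B -> gromov_open (A `&` B).
Proof.
move=> Ao Bo u l uAB ul [Al Bl].
have [AF|/existsNP[N AN]] :=
    pselect (forall N, exists2 m, (N <= m)%N & ~ A (u m)).
  have [phi phiS phiA] := frequently_subseq AF.
  exact: (Ao (u \o phi) l phiA (gromov_cvg_subseq phiS ul)).
have phiS : strictly_increasing (addn N) by move=> i j; rewrite ltn_add2l.
apply: (Bo (u \o addn N) l _ (gromov_cvg_subseq phiS ul)) => // m /= Bu.
apply: (uAB (N + m)%N); split => //; apply: contrapT => nA.
by apply: AN; exists (N + m)%N => //; exact: leq_addr.
Qed.

Lemma gromov_open_bigU o (I : Type) (f : I -> set (gromov_closure o)) :
  (forall i, gromov_open (f i)) -> gromov_open (\bigcup_i f i).
Proof.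
move=> fo u l uf ul [i _ fil]; apply: (fo i u l) => // m fum.
by apply: (uf m); exists i.
Qed.

HB.instance Definition _ o := gen_eqMixin (gromov_closure o).
HB.instance Definition _ o := gen_choiceMixin (gromov_closure o).
HB.instance Definition _ o :=
  isOpenTopological.Build (gromov_closure o)
    (@gromov_openT o) (@gromov_openI o) (@gromov_open_bigU o).

End Gromov.

Section Visibility.
Context {R : realType} {n : nat}.
Implicit Type Omega : set 'rV[R]_n.

Definition qh_visibility_domain Omega : Prop :=
  forall p q, boundary Omega p -> boundary Omega q -> p <> q ->
  exists U V K : set 'rV[R]_n,
    [/\ nbhs p U, nbhs q V, closure U `&` closure V = set0,
        compact K /\ K `<=` Omega &
        forall T (g : R -> 'rV[R]_n), geodesic Omega (qh_dist Omega) T g ->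
          U (g 0) -> V (g T) -> (g @` `[0, T]) `&` K !=set0].

(* Phi is valued in R^n with range exactly the closure of Omega, i.e. it is a
   surjection onto this closure with the subspace topology. *)
Definition extends_identity Omega o
    (Phi : gromov_closure Omega (qh_dist Omega) o -> 'rV[R]_n) : Prop :=
  [/\ continuous Phi, range Phi = closure Omega &
      forall x : {x | Omega x}, Phi (Inner _ _ x) = sval x].

End Visibility.

(* Main.v *)
Require Import Defs.
From mathcomp Require Import all_boot all_order all_algebra.
From mathcomp Require Import all_classical all_reals all_analysis.
From mathcomp Require Import ring lra.
Import Order.TTheory GRing.Theory Num.Theory.
Import numFieldNormedType.Exports.
Local Open Scope classical_set_scope.
Local Open Scope ring_scope.

(** The proof has a metric part, about the quasihyperbolic distance [k], and a
    part about rays.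

    The metric part shows that (Omega, k) is a proper geodesic space with the
    Euclidean topology.  Parametrisation by arclength ([qh_dist_setE]) makes [k]
    an infimum over unit-speed curves, for which concatenation, reversal,
    restriction and segments are immediate; this rests on the description of
    length as the least superadditive majorant of the chord length
    ([curve_length_min]).  Along a curve of length l starting at x, the boundary
    distance at time s is at most bdist x + s, whence k(x, y) is at least
    ln (1 + |x - y| / bdist x) ([qh_dist_lower_log]).  So the boundary distance is
    bounded below on k-balls, and these are compact ([qh_ball_compact]).
    Geodesics are then ultralimits of almost shortest curves
    ([qh_geodesic_exists]).

    From visibility to the extension: visibility forbids geodesics which join
    points near p to points near q, for distinct boundary points p and q, and
    which leave every compact set ([visibility_no_escape]).  Three families of
    such geodesics are excluded.  Late subsegments of one ray: so every ray lands
    at a boundary point ([ray_lands]).  Geodesics between two equivalent rays: so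
    the landing point depends only on the ideal point
    ([equivalent_rays_land]).  Final pieces of rays or segments which converge
    to a ray: so the extension is continuous ([extension_closed]).  It is
    surjective because geodesics to a sequence tending to a boundary point
    subconverge to a ray ([escaping_subseq]).

    From the extension to visibility: if visibility fails, there are geodesics
    that leave every ball and whose endpoints x_m, y_m tend to distinct boundary
    points p, q.  In the thin triangle with vertices o, x_m, y_m the side opposite
    to o is far away, so the other two sides fellow-travel for a long time
    ([far_geodesics_fellow_travel]).  Hence x_m and y_m subconverge to the same
    ideal point, and continuity of the extension gives p = q. *)

Set Implicit Arguments.
Unset Strict Implicit.
Unset Printing Implicit Defensive.

(* The Euclidean distance, as opposed to the extended distance of a pseudometric
   space, which has the same name. *)
Local Notation edist := Defs.edist.

(** * The Euclidean distance *)

Section EuclideanDistance.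
Context {R : realType} {n : nat}.
Implicit Types (x y z : 'rV[R]_n) (A : set 'rV[R]_n).

Lemma edist_ge0 x y : 0 <= edist x y.
Proof. exact: sqrtr_ge0. Qed.

Lemma edistxx x : edist x x = 0.
Proof.
rewrite /edist big1 ?sqrtr0// => i _.
by rewrite subrr expr0n.
Qed.

Lemma edistC x y : edist x y = edist y x.
Proof.
by congr Num.sqrt; apply: eq_bigr => i _; rewrite -sqrrN opprB.
Qed.

Lemma edist_sqr x y : edist x y ^+ 2 = \sum_(i < n) (x 0 i - y 0 i) ^+ 2.
Proof. by rewrite sqr_sqrtr// sumr_ge0// => i _; exact: sqr_ge0. Qed.

Lemma coord_le_edist x y i : `|x 0 i - y 0 i| <= edist x y.
Proof.
rewrite -sqrtr_sqr ler_wsqrtr// (bigD1 i)//= lerDl.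
by apply: sumr_ge0 => j _; exact: sqr_ge0.
Qed.

Lemma edist_eq0 x y : edist x y = 0 -> x = y.
Proof.
move=> xy0; apply/rowP => i; apply/eqP; rewrite -subr_eq0 -normr_le0 -xy0.
exact: coord_le_edist.
Qed.

Lemma edist_triangle y x z : edist x z <= edist x y + edist y z.
Proof.
have [/eqP/edist_eq0->|xy0] := boolP (edist x y == 0).
  by rewrite edistxx add0r.
have [/eqP/edist_eq0->|yz0] := boolP (edist y z == 0).
  by rewrite edistxx addr0.
have xyp : 0 < edist x y by rewrite lt_def xy0 edist_ge0.
have yzp : 0 < edist y z by rewrite lt_def yz0 edist_ge0.
set A := edist x y in xyp *; set B := edist y z in yzp *.
pose C := \sum_(i < n) (x 0 i - y 0 i) * (y 0 i - z 0 i).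
(* Cauchy-Schwarz, from the square of B (x - y) - A (y - z) *)
have CAB : C <= A * B.
  have : 0 <= \sum_(i < n) (B * (x 0 i - y 0 i) - A * (y 0 i - z 0 i)) ^+ 2.
    by apply: sumr_ge0 => i _; exact: sqr_ge0.
  have -> : \sum_(i < n) (B * (x 0 i - y 0 i) - A * (y 0 i - z 0 i)) ^+ 2 =
      B ^+ 2 * A ^+ 2 + A ^+ 2 * B ^+ 2 - 2 * A * B * C.
    rewrite {1}(edist_sqr x y : A ^+ 2 = _) {2}(edist_sqr y z : B ^+ 2 = _).
    rewrite !mulr_sumr -big_split -sumrB /=.
    by apply: eq_bigr => i _; ring.
  rewrite subr_ge0 => h.
  have : (A * B) * C <= (A * B) * (A * B) by nra.
  by rewrite ler_pM2l// mulr_gt0.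
rewrite -ler_sqr ?nnegrE ?edist_ge0 ?addr_ge0// ?(ltW xyp) ?(ltW yzp)//.
have -> : edist x z ^+ 2 = A ^+ 2 + B ^+ 2 + 2 * C.
  rewrite /A /B !edist_sqr mulr_sumr -!big_split /=.
  by apply: eq_bigr => i _; ring.
nra.
Qed.

Lemma edist_le_norm x y : edist x y <= n%:R * `|x - y|.
Proof.
have [n0|n0] := posnP n.
  rewrite /edist big1 ?sqrtr0 ?mulr_ge0// => i _.
  by have := ltn_ord i; rewrite {2}n0.
have -> : n%:R * `|x - y| = Num.sqrt ((n%:R * `|x - y|) ^+ 2).
  by rewrite sqrtr_sqr ger0_norm// mulr_ge0.
rewrite ler_wsqrtr//.
apply: (@le_trans _ _ (\sum_(i < n) `|x - y| ^+ 2)).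
  apply: ler_sum => i _; rewrite -real_normK ?num_real//.
  rewrite ler_sqr ?nnegrE//.
  have -> : x 0 i - y 0 i = (x - y) 0 i by rewrite !mxE.
  rewrite [leRHS]/Num.norm /= mx_normrE.
  by apply/bigmax_geP; right => /=; exists (0, i).
rewrite sumr_const card_ord exprMn -[leLHS]mulr_natl ler_wpM2r ?sqr_ge0//.
by rewrite expr2 -natrM ler_nat leq_pmulr.
Qed.

Lemma norm_le_edist x y : `|x - y| <= edist x y.
Proof.
rewrite [leLHS]/Num.norm /= mx_normrE; apply: bigmax_le; first exact: edist_ge0.
by move=> [i j] _ /=; rewrite !mxE ord1; exact: coord_le_edist.
Qed.

(** The topology of ['rV[R]_n] comes from the sup norm, which is equivalent to
    the Euclidean distance; all topological notions are used through this
    equivalence. *)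
Lemma nbhs_edistP x A :
  nbhs x A <-> exists2 e : R, 0 < e & forall y, edist y x < e -> A y.
Proof.
split.
  move=> /nbhs_ballP[e /= e0 xA]; exists e => // y yx.
  apply: xA; rewrite -ball_normE /ball_ /=.
  by rewrite (le_lt_trans (norm_le_edist _ _))// edistC.
move=> [e e0 eA]; apply/nbhs_ballP; exists (e / n.+1%:R) => /=.
  by rewrite divr_gt0.
move=> y; rewrite -ball_normE /ball_ /= => xy; apply: eA.
rewrite edistC; apply: (le_lt_trans (edist_le_norm _ _)).
move: xy; rewrite ltr_pdivlMr// => xy.
apply: le_lt_trans xy; rewrite mulrC ler_wpM2l//.
by rewrite ler_nat.
Qed.

End EuclideanDistance.

(** * Length of curves *)

Section CurveLength.
Context {R : realType} {n : nat}.
Implicit Types (a b c : R) (g h : R -> 'rV[R]_n).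

Lemma curve_variation_nil a b g : curve_variation a b g [::] = 0.
Proof. by rewrite /curve_variation big_nil. Qed.

Lemma curve_variation_cons a b c g s :
  curve_variation a b g (c :: s) =
  edist (g a) (g c) + curve_variation c b g s.
Proof. by rewrite /curve_variation /= big_nat_recl//= edistC. Qed.

Lemma curve_variation_cat a b c g s t : last a s = c ->
  curve_variation a b g (s ++ t) =
  curve_variation a c g s + curve_variation c b g t.
Proof.
elim: s a => [|x s IH] a /= lastc.
  by rewrite lastc curve_variation_nil add0r.
by rewrite !curve_variation_cons IH// addrA.
Qed.

Lemma curve_length_ub a b g s : itv_partition a b s ->
  ((curve_variation a b g s)%:E <= curve_length a b g)%E.
Proof. by move=> sab; apply: ereal_sup_ubound; exists s. Qed.

Lemma edist_le_length a b g : a <= b ->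
  ((edist (g a) (g b))%:E <= curve_length a b g)%E.
Proof.
rewrite le_eqVlt => /predU1P[<-|ab].
  rewrite edistxx -(curve_variation_nil a a g).
  by apply: curve_length_ub; split => /=.
have := curve_length_ub g (itv_partition1 ab).
by rewrite curve_variation_cons curve_variation_nil addr0.
Qed.

Lemma curve_length_ge0 a b g : a <= b -> (0 <= curve_length a b g)%E.
Proof.
move=> ab; apply: le_trans (edist_le_length g ab).
by rewrite lee_fin edist_ge0.
Qed.

Lemma curve_length_super a b c g : a <= c -> c <= b ->
  (curve_length a c g + curve_length c b g <= curve_length a b g)%E.
Proof.
move=> ac cb.
have [/eqP->|hfin] := boolP (curve_length a b g == +oo)%E; first by rewrite leey.
have {}hfin : (curve_length a b g < +oo)%E by rewrite lt_neqAle hfin leey.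
have key s : itv_partition a c s ->
    ((curve_variation a c g s)%:E + curve_length c b g <= curve_length a b g)%E.
  move=> ps; rewrite -leeBrDl//; apply: ge_ereal_sup => _ [t pt <-].
  rewrite leeBrDl// -EFinD -(curve_variation_cat _ _ (c := c)); last first.
    by case: ps => _ /eqP.
  exact/curve_length_ub/(itv_partition_cat ps pt).
have [s0 ps0] : exists s, itv_partition a c s.
  move: ac; rewrite le_eqVlt => /predU1P[<-|/itv_partition1]; last by exists [:: c].
  by exists [::]; split => /=.
have cbfin : curve_length c b g \is a fin_num.
  rewrite ge0_fin_numE ?curve_length_ge0//.
  have := key _ ps0; rewrite -leeBrDl// => /le_lt_trans; apply.
  by rewrite lteBlDr// addye.
rewrite -leeBrDr//; apply: ge_ereal_sup => _ [s ps <-].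
by rewrite leeBrDr//; exact: key.
Qed.

(** The length of [g] is the least superadditive function of intervals which
    dominates the distance between endpoints: a partition sum is bounded term
    by term.  All upper bounds of lengths below are instances. *)
Lemma curve_length_min a b g (L : R -> R -> R) : a <= b ->
  (forall s t, a <= s -> s <= t -> t <= b -> edist (g s) (g t) <= L s t) ->
  (forall s r t, a <= s -> s <= r -> r <= t -> t <= b ->
    L s r + L r t <= L s t) ->
  (curve_length a b g <= (L a b)%:E)%E.
Proof.
move=> ab Lge Lsup; apply: ge_ereal_sup => _ [s [ps /eqP lasts] <-].
rewrite lee_fin.
elim: s a ab Lge Lsup ps lasts => [|c s IH] a ab Lge Lsup /=.
  move=> _ <-; rewrite curve_variation_nil.
  by apply: le_trans (Lge a a _ _ _); rewrite ?edist_ge0.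
move=> /andP[ac ps] lasts.
have cb : c <= b by apply: (itv_partition_le (s := s)); split => //; exact/eqP.
rewrite curve_variation_cons.
apply: le_trans (Lsup a c b _ _ _ _) => //; last exact: ltW.
rewrite lerD ?Lge//; first exact: ltW.
apply: IH => // [u t cu|u r t cu]; first by apply: Lge; exact: le_trans (ltW ac) cu.
by apply: Lsup; exact: le_trans (ltW ac) cu.
Qed.

Lemma curve_lengthxx a g : curve_length a a g = 0%E.
Proof.
apply/le_anti; rewrite curve_length_ge0// andbT.
apply: (@curve_length_min a a g (fun _ _ => 0)) => //.
  move=> s t as_ st ta; have -> : t = s by lra.
  by rewrite edistxx.
Qed.

Lemma curve_length_lip a b g : a <= b ->
  (forall s t, a <= s -> s <= t -> t <= b -> edist (g s) (g t) <= t - s) ->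
  (curve_length a b g <= (b - a)%:E)%E.
Proof.
move=> ab gl; apply: (@curve_length_min a b g (fun s t => t - s)) => //.
by move=> s r t *; lra.
Qed.

Lemma curve_length_sub a b s t g : a <= s -> s <= t -> t <= b ->
  (curve_length s t g <= curve_length a b g)%E.
Proof.
move=> as_ st tb.
apply: le_trans (curve_length_super (c := s) _ as_ _); last exact: le_trans tb.
apply: (@le_trans _ _ (curve_length s b g)); last first.
  by rewrite leeDr// curve_length_ge0.
by apply: le_trans (curve_length_super _ st tb); rewrite leeDl// curve_length_ge0.
Qed.

Lemma curve_length_fin a b s t g : rectifiable a b g ->
  a <= s -> s <= t -> t <= b ->
  curve_length s t g = (fine (curve_length s t g))%:E.
Proof.
move=> rg as_ st tb; rewrite fineK// ge0_fin_numE ?curve_length_ge0//.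
exact: le_lt_trans (curve_length_sub g as_ st tb) rg.
Qed.

Lemma curve_length_add a b c g : a <= c -> c <= b ->
  curve_length a b g = (curve_length a c g + curve_length c b g)%E.
Proof.
move=> ac cb; apply/le_anti; rewrite curve_length_super// andbT.
have [acy|acy] := boolP (curve_length a c g == +oo)%E.
  rewrite (eqP acy) addye ?leey//.
  by rewrite gt_eqF// (lt_le_trans _ (curve_length_ge0 g cb))// ltNyr.
have [cby|cby] := boolP (curve_length c b g == +oo)%E.
  rewrite (eqP cby) addey ?leey//.
  by rewrite gt_eqF// (lt_le_trans _ (curve_length_ge0 g ac))// ltNyr.
have rac : rectifiable a c g by rewrite /rectifiable lt_neqAle acy leey.
have rcb : rectifiable c b g by rewrite /rectifiable lt_neqAle cby leey.
pose l s t := fine (curve_length s t g).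
have lad s r t u v : rectifiable u v g ->
    u <= s -> s <= r -> r <= t -> t <= v -> l s r + l r t <= l s t.
  move=> ruv us sr rt tv; rewrite -lee_fin EFinD -!(curve_length_fin ruv)//.
  - exact: curve_length_super.
  - exact: le_trans rt.
  - exact: le_trans us sr.
  - exact: le_trans rt tv.
have le s t u v : rectifiable u v g -> u <= s -> s <= t -> t <= v ->
    edist (g s) (g t) <= l s t.
  move=> ruv us st tv; rewrite -lee_fin -(curve_length_fin ruv)//.
  exact: edist_le_length.
(* [L] charges an interval around [c] for its two halves, which is what
   inserting [c] into a partition does. *)
pose L s t := if t <= c then l s t else if c <= s then l s t
              else l s c + l c t.
suff : (curve_length a b g <= (L a b)%:E)%E.
  rewrite /L; case: ifPn => [bc|bc].
    have -> : c = b by lra.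
    rewrite -(@curve_length_fin a b) ?curve_lengthxx ?adde0//; [|lra].
    by have -> : b = c by lra.
  case: ifPn => [ca|ca].
    have -> : c = a by lra.
    rewrite -(@curve_length_fin a b) ?curve_lengthxx ?add0e//; [|lra].
    by have -> : a = c by lra.
  by rewrite EFinD -(curve_length_fin rac)// -(curve_length_fin rcb).
apply: curve_length_min => [|s t as_ st tb|s r t as_ sr rt tb].
- exact: le_trans cb.
- rewrite /L; case: ifPn => tc; first exact: (le _ _ a c).
  case: ifPn => cs; first exact: (le _ _ c b).
  apply: (le_trans (edist_triangle (g c) _ _)).
  by apply: lerD; [apply: (le _ _ a c)|apply: (le _ _ c b)] => //; lra.
- have lxx u v w : rectifiable u v g -> u <= w -> w <= v -> l w w = 0.
    by move=> _ _ _; rewrite /l curve_lengthxx.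
  rewrite /L; case: (leP t c) => tc.
    have rc : r <= c by lra.
    by rewrite rc; apply: (lad _ _ _ a c).
  case: (leP c s) => cs.
    have cr : c <= r by lra.
    by rewrite cr; case: (leP r c) => rc; apply: (lad _ _ _ c b).
  case: (leP r c) => rc.
    case: (leP c r) => cr.
      have -> : r = c by lra.
      by rewrite lerD2l.
    by rewrite addrA lerD2r; apply: (lad _ _ _ a c) => //; lra.
  rewrite (ltW rc) -addrA lerD2l; apply: (lad _ _ _ c b) => //; lra.
Qed.

(** The length of [h] between the values of [v] is superadditive in the
    parameter of [g], so minimality applies, even if [v] is constant on some
    intervals. *)
Lemma curve_length_reparam a b g h (v : R -> R) : a <= b ->
  (forall s t, a <= s -> s <= t -> t <= b -> v s <= v t) ->
  (forall t, a <= t -> t <= b -> g t = h (v t)) ->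
  (curve_length a b g <= curve_length (v a) (v b) h)%E.
Proof.
move=> ab vmono gh.
have [/eqP->|hfin] := boolP (curve_length (v a) (v b) h == +oo)%E.
  by rewrite leey.
have rh : rectifiable (v a) (v b) h by rewrite /rectifiable lt_neqAle hfin leey.
rewrite [leRHS](curve_length_fin rh) ?vmono//.
apply: (@curve_length_min a b g
  (fun s t => fine (curve_length (v s) (v t) h))) => //.
  move=> s t as_ st tb; rewrite -lee_fin -(curve_length_fin rh); [|apply: vmono; lra..].
  rewrite !gh; [|lra..].
  by rewrite edist_le_length// vmono.
move=> s r t as_ sr rt tb.
rewrite -lee_fin EFinD -!(curve_length_fin rh); [|apply: vmono; lra..].
by rewrite curve_length_super// vmono//; lra.
Qed.

Lemma curve_length_rev a b g : a <= b ->
  curve_length a b g = curve_length (- b) (- a) (g \o -%R).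
Proof.
have half u v h : u <= v ->
    (curve_length u v h <= curve_length (- v)%R (- u)%R (h \o -%R))%E.
  move=> uv.
  have [/eqP->|hfin] :=
      boolP (curve_length (- v)%R (- u)%R (h \o -%R) == +oo)%E.
    by rewrite leey.
  have rh : rectifiable (- v) (- u) (h \o -%R).
    by rewrite /rectifiable lt_neqAle hfin leey.
  rewrite [leRHS](curve_length_fin rh)//; last lra.
  apply: (@curve_length_min u v h
    (fun s t => fine (curve_length (- t) (- s) (h \o -%R)))) => //.
    move=> s t us st tv; rewrite -lee_fin -(curve_length_fin rh); [|lra..].
    apply: le_trans (edist_le_length _ _); last lra.
    by rewrite /= !opprK edistC.
  move=> s r t us sr rt tv.
  rewrite -lee_fin EFinD -!(curve_length_fin rh); [|lra..].
  by rewrite addeC curve_length_super//; lra.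
move=> ab; apply/le_anti; rewrite half//=.
have := half (- b) (- a) (g \o -%R); rewrite !opprK.
have -> : (g \o -%R) \o -%R = g by apply/funext => t /=; rewrite opprK.
by apply; lra.
Qed.

End CurveLength.

(** * Parametrisation by arclength *)

Section Arclength.
Context {R : realType} {n : nat}.
Implicit Types (a b c s t u : R) (g h : R -> 'rV[R]_n).

Definition edist_continuous a b g : Prop :=
  forall c (e : R), a <= c -> c <= b -> 0 < e ->
  exists2 d : R, 0 < d & forall t, a <= t -> t <= b -> `|t - c| < d ->
    edist (g t) (g c) < e.

Lemma edist_continuousP a b g :
  {within `[a, b], continuous g} <-> edist_continuous a b g.
Proof.
split.
  move=> /subspace_continuousP gc c e ac cb e0.
  have /(gc c) gcc : `[a, b]%classic c by rewrite /= in_itv /= ac.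
  have /gcc : nbhs (g c) [set y | edist y (g c) < e] by apply/nbhs_edistP; exists e.
  rewrite /= /nbhs/= => /nbhs_ballP[d /= d0 cd]; exists d => // t at_ tb tc.
  apply: cd; first by rewrite /ball /= distrC.
  by rewrite /= in_itv /= at_.
move=> gc; apply/subspace_continuousP => c; rewrite /= in_itv /= => /andP[ac cb].
move=> A /nbhs_edistP[e e0 eA].
have [d d0 cd] := gc c e ac cb e0.
apply/nbhs_ballP; exists d => //= t; rewrite -ball_normE /ball_ /= => ct.
by rewrite in_itv /= => /andP[at_ tb]; apply: eA; apply: cd; rewrite // distrC.
Qed.

(** By continuity at [c], the last step of a partition of [[a, c]] can be cut
    just before [c].  The majorant [L] encodes this: an interval ending at [c]
    is charged with what the interval before it leaves of the budget [r]. *)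
Lemma curve_length_lsc_left a b c g (r : R) : rectifiable a b g ->
  edist_continuous a b g -> a < c -> c <= b ->
  (forall t, a <= t -> t < c -> (curve_length a t g <= r%:E)%E) ->
  (curve_length a c g <= r%:E)%E.
Proof.
move=> rg gc ac cb hr.
pose l s t := fine (curve_length s t g).
have lad s u t : a <= s -> s <= u -> u <= t -> t <= b -> l s u + l u t = l s t.
  move=> as_ su ut tb; apply: EFin_inj.
  by rewrite EFinD -!(curve_length_fin rg) -?curve_length_add//; lra.
have laa u : l u u = 0 by rewrite /l curve_lengthxx.
have hl t : a <= t -> t < c -> l a t <= r.
  move=> at_ tc; rewrite -lee_fin -(curve_length_fin rg) ?hr//; lra.
pose L u w := if (w == c) && (u < c) then r - l a u else l u w.
have -> : r = L a c by rewrite /L eqxx ac laa subr0.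
apply: curve_length_min => [|s t as_ st tc|s u t as_ su ut tc]; first lra.
  rewrite /L; case: ifPn => [/andP[/eqP -> sc]|_]; last first.
    rewrite -lee_fin -(curve_length_fin rg); [|lra..].
    exact: edist_le_length.
  apply/ler_addgt0Pr => e e0.
  have [d d0 cd] := gc c e (ltW ac) cb e0.
  pose u := Num.max s (c - d / 2).
  have [su uc cdu] : [/\ s <= u, u < c & c - d / 2 <= u].
    by rewrite /u; split; rewrite ?le_max ?gt_max ?lexx ?orbT ?sc//=; lra.
  apply: (le_trans (edist_triangle (g u) _ _)); apply: lerD; last first.
    by apply/ltW/cd; [lra|lra|rewrite ltr_norml; apply/andP; split; lra].
  apply: (@le_trans _ _ (l s u)).
    rewrite -lee_fin -(curve_length_fin rg); [|lra..].
    exact: edist_le_length.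
  have := hl u (le_trans as_ su) uc; rewrite -(lad a s u) //; lra.
rewrite /L; have [tc'|tc'] := eqVneq t c; last first.
  have uc : (u == c) = false by apply/negbTE/eqP => uc; move: tc' => /eqP; apply; lra.
  by rewrite uc /= lad//; lra.
rewrite tc' in ut tc *; have [uc|uc] /= := eqVneq u c.
  by rewrite uc ltxx laa addr0.
have uc' : u < c by rewrite lt_neqAle uc.
rewrite uc' (le_lt_trans su uc') -(lad a s u)//; lra.
Qed.

(** The previous lemma for the reversed curve. *)
Lemma curve_length_lsc_right a b c g (r : R) : rectifiable a b g ->
  edist_continuous a b g -> a <= c -> c < b ->
  (forall t, c < t -> t <= b -> (curve_length t b g <= r%:E)%E) ->
  (curve_length c b g <= r%:E)%E.
Proof.
move=> rg gc ac cb hr.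
rewrite curve_length_rev ?(ltW cb)//.
apply: (@curve_length_lsc_left (- b) (- a)); [| |lra|lra|].
- by rewrite /rectifiable -curve_length_rev//; lra.
- move=> u e bu ua e0; have [||d d0 hd] := gc (- u) e _ _ e0; [lra..|].
  exists d => // t bt ta tu; apply: hd; [lra..|].
  by rewrite -opprD normrN.
- move=> t bt tc; have -> : t = - - t by rewrite opprK.
  by rewrite -curve_length_rev ?hr//; lra.
Qed.

(** The length from the start takes all intermediate values: at the last
    parameter where it is at most [s], the two semicontinuities and additivity
    force equality. *)
Lemma curve_length_surj a b g (s : R) : a <= b -> rectifiable a b g ->
  edist_continuous a b g -> 0 <= s -> (s%:E <= curve_length a b g)%E ->
  exists t, [/\ a <= t, t <= b & curve_length a t g = s%:E].
Proof.
move=> ab rg gc s0 sl.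
pose E := [set t | [/\ a <= t, t <= b & (curve_length a t g <= s%:E)%E]].
have Ea : E a by split; rewrite ?curve_lengthxx ?lee_fin.
have Esup : has_sup E by split; [exists a|exists b => t []].
pose c := sup E.
have ac : a <= c by apply: ub_le_sup => //; case: Esup.
have cb : c <= b by apply: ge_sup => [|t []]; first by exists a.
exists c; split => //; apply/le_anti/andP; split.
  have [<-|nac] := eqVneq a c; first by rewrite curve_lengthxx lee_fin.
  have {}ac : a < c by rewrite lt_neqAle nac.
  apply: (@curve_length_lsc_left a b) => // t at_ tc.
  have [|u [au ub us]] := @sup_adherent _ _ (c - t) _ Esup; first by rewrite subr_gt0.
  rewrite -/c subKr => tu; apply: le_trans us.
  by apply: curve_length_sub => //; exact: ltW.
have /esym fac := curve_length_fin rg (lexx a) ac cb.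
have /esym fcb := curve_length_fin rg ac cb (lexx b).
move: sl; rewrite (curve_length_add g ac cb) -fac -fcb -EFinD !lee_fin => sl.
suff : fine (curve_length c b g) <=
    fine (curve_length a c g) + fine (curve_length c b g) - s by lra.
rewrite -lee_fin fcb; set r := (X in (_ <= X%:E)%E).
have [->|ncb] := eqVneq c b.
  by rewrite curve_lengthxx lee_fin /r; lra.
have {}ncb : c < b by rewrite lt_neqAle ncb.
apply: (@curve_length_lsc_right a b) => // t ct tb.
have at_ : a <= t := le_trans ac (ltW ct).
have /esym fat := curve_length_fin rg (lexx a) at_ tb.
have /esym ftb := curve_length_fin rg at_ tb (lexx b).
have : (curve_length a b g = curve_length a b g) by [].
rewrite {1}(curve_length_add g at_ tb) (curve_length_add g ac cb).
rewrite -fac -fcb -fat -ftb -!EFinD => -[lsum].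
rewrite lee_fin /r -lsum.
suff : s <= fine (curve_length a t g) by lra.
have [//|ts] := leP s (fine (curve_length a t g)).
suff /(ub_le_sup Esup.2) : E t by rewrite -/c leNgt ct.
by split => //; rewrite -fat lee_fin ltW.
Qed.

(** Parametrisation by arclength, up to a translation of the parameter. *)
Definition unit_speed a b g : Prop :=
  forall s t, a <= s -> s <= t -> t <= b -> curve_length s t g = (t - s)%:E.

Lemma unit_speed_lip a b g s t : unit_speed a b g ->
  a <= s -> s <= t -> t <= b -> edist (g s) (g t) <= t - s.
Proof. by move=> ug as_ st tb; rewrite -lee_fin -ug// edist_le_length. Qed.

Lemma unit_speed_continuous a b g : unit_speed a b g ->
  {within `[a, b], continuous g}.
Proof.
move=> ug; apply/edist_continuousP => c e ac cb e0; exists e => // t at_ tb.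
apply: le_lt_trans; have [ct|tc] := leP c t.
  by rewrite edistC (le_trans (unit_speed_lip ug _ ct _))// ler_norm.
rewrite (le_trans (unit_speed_lip ug _ (ltW tc) _))//.
by rewrite distrC ler_norm.
Qed.

(** By additivity of length, a loss on a subinterval could not be compensated
    on the rest of the interval, where length is at most the increment of the
    parameter. *)
Lemma lip_unit_speed a b g : a <= b ->
  (forall s t, a <= s -> s <= t -> t <= b -> edist (g s) (g t) <= t - s) ->
  ((b - a)%:E <= curve_length a b g)%E -> unit_speed a b g.
Proof.
move=> ab glip gab s t as_ st tb.
have lip u v : a <= u -> u <= v -> v <= b ->
    (curve_length u v g <= (v - u)%:E)%E.
  by move=> au uv vb; apply: curve_length_lip => // p q *; apply: glip; lra.
apply/le_anti; rewrite lip//=.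
have rg : rectifiable a b g by rewrite /rectifiable (le_lt_trans (lip a b _ _ _))// ltry.
have sb : s <= b by lra.
move: gab (lip a s) (lip t b).
rewrite (curve_length_add g as_ sb) (curve_length_add g st tb).
rewrite (curve_length_fin rg (lexx a) as_ sb) (curve_length_fin rg as_ st tb).
rewrite (curve_length_fin rg (le_trans as_ st) tb (lexx b)).
rewrite -!EFinD !lee_fin => gab /(_ (lexx a) as_ sb) las.
by move=> /(_ (le_trans as_ st) tb (lexx b)); lra.
Qed.

Lemma arclength_param_id a b g (s : R) : unit_speed a b g ->
  0 <= s -> s <= b - a -> arclength_param a b g s = g (a + s).
Proof.
move=> ug s0 sb; congr g; case: xgetP => [t _|/(_ (a + s))]; last first.
  case; split; first by rewrite in_itv/=; lra.
  by rewrite ug; [congr EFin; ring|lra..].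
move=> [+ +]; rewrite in_itv/= => /andP[at_ tb]; rewrite ug// => -[]; lra.
Qed.

Lemma curve_length_unit_speed a b g : unit_speed a b g -> a <= b ->
  curve_length a b g = (b - a)%:E.
Proof. by move=> ug ab; exact: ug. Qed.

(** A curve is constant where the length from its start is, hence it factors
    through that length function; the factor is 1-Lipschitz, and its total
    length is at least that of the curve because the curve reparametrises it. *)
Lemma arclength_param_unit_speed a b g : a <= b ->
  rectifiable a b g -> {within `[a, b], continuous g} ->
  let l := fine (curve_length a b g) in
  let h := arclength_param a b g in
  [/\ unit_speed 0 l h, h 0 = g a, h l = g b &
      forall s : R, 0 <= s -> s <= l -> exists2 t, t \in `[a, b] & h s = g t].
Proof.
move=> ab rg /edist_continuousP gc l h.
have fl : curve_length a b g = l%:E by exact: curve_length_fin rg _ _ _.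
have hP s : 0 <= s -> s <= l ->
    exists t, [/\ a <= t, t <= b, curve_length a t g = s%:E & h s = g t].
  move=> s0 sl; rewrite /h /arclength_param; case: xgetP => [t _ []|].
    by rewrite in_itv/= => /andP[at_ tb] lt; exists t.
  have [|t [at_ tb lt]] := curve_length_surj ab rg gc s0; first by rewrite fl lee_fin.
  by move=> /(_ t) []; rewrite /= in_itv /= at_ tb.
have l0 : 0 <= l by rewrite -lee_fin -fl curve_length_ge0.
have const s t : a <= s -> s <= t -> t <= b ->
    curve_length a s g = curve_length a t g -> g s = g t.
  move=> as_ st tb eq_len; apply: edist_eq0; apply/le_anti.
  rewrite edist_ge0 andbT -lee_fin; apply: (le_trans (edist_le_length g st)).
  move: eq_len; rewrite (curve_length_add g as_ st).
  have sb : s <= b by lra.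
  rewrite (curve_length_fin rg (lexx a) as_ sb) (curve_length_fin rg as_ st tb).
  by rewrite -EFinD lee_fin => -[]; lra.
have const2 s t : a <= s -> s <= b -> a <= t -> t <= b ->
    curve_length a s g = curve_length a t g -> g s = g t.
  move=> as_ sb at_ tb eq_len; have [st|/ltW ts] := leP s t; first exact: const.
  exact/esym/const.
have hE t : a <= t -> t <= b -> h (fine (curve_length a t g)) = g t.
  move=> at_ tb; have /esym ft := curve_length_fin rg (lexx a) at_ tb.
  have [||u [au ub lu ->]] := hP (fine (curve_length a t g)).
  - by rewrite -lee_fin ft curve_length_ge0.
  - by rewrite -lee_fin ft -fl curve_length_sub.
  - by apply: const2 => //; rewrite lu ft.
split; last 1 first.
- by move=> s s0 sl; have [t [at_ tb _ ->]] := hP s s0 sl; exists t; rewrite ?in_itv /= ?at_.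
- apply: lip_unit_speed => // [s t s0 st tl|].
    have [||u [au ub lu ->]] := hP s; [lra..|].
    have [||v [av vb lv ->]] := hP t; [lra..|].
    rewrite -lee_fin EFinB -lu -lv.
    have [uv|vu] := leP u v.
      rewrite leeBrDl; last by rewrite lu.
      rewrite (curve_length_add g au uv) leeD2l//; exact: edist_le_length.
    have := curve_length_sub g (lexx a) av (ltW vu); rewrite lu lv lee_fin => ts.
    rewrite (const2 u v)//; last by rewrite lu lv; congr EFin; lra.
    by rewrite edistxx -EFinB lee_fin; lra.
  rewrite subr0 -fl.
  have -> : 0 = fine (curve_length a a g) by rewrite curve_lengthxx.
  rewrite /l; apply: (curve_length_reparam (v := fun t => fine (curve_length a t g))) => //.
    move=> s t as_ st tb; rewrite -lee_fin -!(curve_length_fin rg); [|lra..].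
    exact: curve_length_sub.
  by move=> t at_ tb; rewrite hE.
- by rewrite -(hE a)// curve_lengthxx.
- by rewrite -(hE b).
Qed.

End Arclength.

(** * Integrals of continuous functions over intervals *)

Section IntervalIntegrals.
Context {R : realType}.
Implicit Types (a b c : R) (f : R -> R).
Let mu := @lebesgue_measure R.

Definition itv_int a b f : R := \int[mu]_(x in `[a, b]) f x.

Lemma itv_integrable a b f : {within `[a, b], continuous f} ->
  mu.-integrable `[a, b] (EFin \o f).
Proof.
by move=> cf; apply: continuous_compact_integrable => //; exact: segment_compact.
Qed.

Lemma within_sub a b c d (T : topologicalType) (f : R -> T) :
  {within `[a, b], continuous f} -> a <= c -> d <= b ->
  {within `[c, d], continuous f}.
Proof.
move=> cf ac db; apply: continuous_subspaceW cf => x /=.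
by rewrite !in_itv/= => /andP[cx xd]; apply/andP; split; lra.
Qed.

Lemma itv_int_add a b c f : {within `[a, b], continuous f} ->
  a <= c -> c <= b -> itv_int a b f = itv_int a c f + itv_int c b f.
Proof.
move=> cf ac cb; apply/eqP; rewrite addrC -subr_eq; apply/eqP.
rewrite /itv_int Rintegral_itvB ?bnd_simp//; last exact: itv_integrable.
apply: Rintegral_itv_obnd_cbnd.
apply: integrableS (itv_integrable cf) => //.
by apply: subset_itv; rewrite bnd_simp.
Qed.

Lemma itv_intxx a f : itv_int a a f = 0.
Proof. by rewrite /itv_int set_itv1 Rintegral_set1. Qed.

Lemma itv_int_le a b f g : {within `[a, b], continuous f} ->
  {within `[a, b], continuous g} ->
  (forall x, a <= x -> x <= b -> f x <= g x) -> itv_int a b f <= itv_int a b g.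
Proof.
move=> cf cg fg; apply: le_Rintegral; [by []|exact: itv_integrable..|].
by move=> x /=; rewrite in_itv/= => /andP[ax xb]; exact: fg.
Qed.

Lemma itv_int_cst a b c : a <= b -> itv_int a b (fun=> c) = c * (b - a).
Proof.
move=> ab; rewrite /itv_int Rintegral_cst//.
congr (c * _); apply: (etrans (congr1 fine (lebesgue_measure_itv `[a, b]))).
rewrite /= lte_fin.
have [//|ba] := ltP a b.
have -> : b = a by lra.
rewrite subrr; reflexivity.
Qed.

Lemma itv_int_ge0 a b f : (forall x, a <= x -> x <= b -> 0 <= f x) ->
  0 <= itv_int a b f.
Proof.
move=> f0; apply: Rintegral_ge0 => x /=; rewrite in_itv/= => /andP[ax xb].
exact: f0.
Qed.

Lemma eq_itv_int a b f g : (forall x, a <= x -> x <= b -> f x = g x) ->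
  itv_int a b f = itv_int a b g.
Proof.
move=> fg; apply: eq_Rintegral => x; rewrite inE/= in_itv/= => /andP[ax xb].
exact: fg.
Qed.

Lemma itv_int_EFin a b f : {within `[a, b], continuous f} ->
  (\int[mu]_(x in `[a, b]) (f x)%:E)%E = (itv_int a b f)%:E.
Proof.
by move=> cf; rewrite /itv_int /Rintegral fineK//; exact/integrable_fin_num/itv_integrable.
Qed.

Lemma itv_int_opp a b f : a <= b -> {within `[a, b], continuous f} ->
  itv_int (- b) (- a) (f \o -%R) = itv_int a b f.
Proof.
move=> ab cf; rewrite /itv_int /Rintegral; congr fine; apply/esym.
have := @integration_by_substitution_oppr R f (- b) (- a).
by rewrite !opprK => -> //; lra.
Qed.

Lemma itv_int_shift a b c f : a <= b -> {within `[a + c, b + c], continuous f} ->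
  itv_int a b (fun x => f (x + c)) = itv_int (a + c) (b + c) f.
Proof.
move=> ab cf; rewrite /itv_int /Rintegral; congr fine; apply/esym.
have dF : derive1 (fun x : R => x + c) = cst 1.
  apply/funext => z; rewrite derive1E deriveD// derive_id derive_cst.
  by rewrite addr0.
rewrite (@integration_by_substitution_increasing R (fun x => x + c))//.
- by apply: eq_integral => x _; rewrite dF /= mulr1.
- by move=> x y _ _ xy; rewrite ltrD2r.
- by rewrite dF => ? _; exact: cvg_cst.
- by rewrite dF; exact: is_cvg_cst.
- by rewrite dF; exact: is_cvg_cst.
- split.
  + by move=> x _; apply: derivableD.
  + by apply: cvgD; [exact: cvg_at_right_filter|exact: cvg_cst].
  + by apply: cvgD; [exact: cvg_at_left_filter|exact: cvg_cst].
Qed.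

Lemma itv_int_IVT a b f v : a <= b -> {within `[a, b], continuous f} ->
  0 <= v -> v <= itv_int a b f ->
  exists t, [/\ a <= t, t <= b & itv_int a t f = v].
Proof.
move=> ab cf v0 vI.
have cI := parameterized_integral_continuous ab (itv_integrable cf).
have [|t] := IVT (v := v) ab cI.
  rewrite [parameterized_integral _ _ a _](itv_intxx a f).
  rewrite [parameterized_integral _ _ b _](_ : _ = itv_int a b f)//.
  have I0 : 0 <= itv_int a b f by exact: le_trans vI.
  by rewrite (min_idPl I0) (max_idPr I0) v0.
by rewrite in_itv/= => /andP[at_ tb] <-; exists t.
Qed.

(** This integral is the source of the logarithmic lower bound for the
    quasihyperbolic distance. *)
Lemma itv_int_inv (c l : R) : 0 < c -> 0 <= l ->
  itv_int 0 l (fun s => (c + s)^-1) = ln (1 + l / c).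
Proof.
move=> c0; rewrite le_eqVlt => /predU1P[<-|l0].
  by rewrite itv_intxx mul0r addr0 ln1.
have cont : {within `[0, l], continuous (fun s : R => (c + s)^-1)}.
  apply: continuous_in_subspaceT => x; rewrite inE/= in_itv/= => /andP[x0 xl].
  apply: cvgV; first by apply: lt0r_neq0; lra.
  by apply: cvgD; [exact: cvg_cst|exact: cvg_id].
have dln (x : R) : 0 <= x -> is_derive x 1 (fun s : R => ln (c + s)) (c + x)^-1.
  move=> x0.
  have h1 : is_derive (c + x) 1 (@ln R) (c + x)^-1 by apply: is_derive1_ln; lra.
  have h2 : is_derive x 1 (fun s : R => c + s) 1.
    by have := is_deriveD (is_derive_cst c x 1) (is_derive_id x 1); rewrite add0r.
  have := @is_derive1_comp R (@ln R) (fun s : R => c + s) x _ _ h1 h2.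
  by rewrite mulr1.
apply: EFin_inj; rewrite -itv_int_EFin//.
rewrite (@continuous_FTC2 R _ (fun s => ln (c + s)))//.
- rewrite addr0 -EFinB -ln_div ?posrE//; last lra.
  by rewrite mulrDl divff// gt_eqF.
- have cln (x : R) : 0 <= x -> {for x, continuous (fun s : R => ln (c + s))}.
    move=> x0; apply: differentiable_continuous; apply/derivable1_diffP.
    by case: (dln x x0).
  split.
  + move=> x; rewrite in_itv/= => /andP[x0 _].
    by case: (dln x (ltW x0)).
  + by apply: cvg_at_right_filter; exact: cln.
  + by apply: cvg_at_left_filter; apply: cln; exact: ltW.
- move=> x; rewrite in_itv/= => /andP[x0 _].
  by rewrite derive1E; case: (dln x (ltW x0)).
Qed.

End IntervalIntegrals.

(** * The distance to the boundary *)

Section BoundaryDistance.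
Context {R : realType} {n : nat}.
Variable Omega : set 'rV[R]_n.
Hypothesis Omega_dom : domain Omega.
Implicit Types (x y z : 'rV[R]_n) (s t : R).

Definition segment_point x y t : 'rV[R]_n := x + t *: (y - x).

Lemma segment_point0 x y : segment_point x y 0 = x.
Proof. by rewrite /segment_point scale0r addr0. Qed.

Lemma segment_point1 x y : segment_point x y 1 = y.
Proof. by rewrite /segment_point scale1r addrC subrK. Qed.

Lemma edist_segment_point x y s t :
  edist (segment_point x y s) (segment_point x y t) = `|s - t| * edist x y.
Proof.
rewrite -[`|_|]sqrtr_sqr -sqrtrM ?sqr_ge0// mulr_sumr; congr Num.sqrt.
by apply: eq_bigr => i _; rewrite !mxE; ring.
Qed.

Lemma domain_ball x : Omega x ->
  exists2 e : R, 0 < e & forall y, edist y x < e -> Omega y.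
Proof.
move=> Ox; apply/nbhs_edistP; apply: open_nbhs_nbhs; split => //.
by case: Omega_dom.
Qed.

Lemma boundaryP z : boundary Omega z <->
  (forall e : R, 0 < e -> exists2 y, Omega y & edist y z < e) /\ ~ Omega z.
Proof.
have Oo : open Omega by case: Omega_dom.
rewrite /boundary (interior_id _).1//; split.
  move=> [cz nz]; split=> // e e0.
  have /cz[y [Oy yz]] : nbhs z [set y | edist y z < e] by apply/nbhs_edistP; exists e.
  by exists y.
move=> [cz nz]; split=> // A /nbhs_edistP[e e0 eA].
by have [y Oy yz] := cz e e0; exists y; split=> //; exact: eA.
Qed.

(** The supremum of the parameters of the points of the segment which lie in
    the domain gives a boundary point. *)
Lemma segment_crosses_boundary x y : Omega x -> ~ Omega y ->
  exists2 z, boundary Omega z & edist x z <= edist x y.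
Proof.
move=> Ox ny.
pose E := [set t | [/\ 0 <= t, t <= 1 & Omega (segment_point x y t)]].
have E0 : E 0 by split; rewrite ?ler01// segment_point0.
have Esup : has_sup E by split; [exists 0|exists 1 => t []].
pose c := sup E.
have c0 : 0 <= c by apply: ub_le_sup => //; case: Esup.
have c1 : c <= 1 by apply: ge_sup => [|t []]; first by exists 0.
exists (segment_point x y c); last first.
  rewrite -{1}(segment_point0 x y) edist_segment_point sub0r normrN ger0_norm//.
  by rewrite ler_piMl ?edist_ge0.
have dxy : 0 < edist x y + 1 by rewrite ltr_wpDl ?edist_ge0.
apply/boundaryP; split.
  move=> e e0; pose d := e / (edist x y + 1).
  have d0 : 0 < d by rewrite divr_gt0.
  have [t [t0 t1 Ot] tc] := sup_adherent d0 Esup.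
  exists (segment_point x y t) => //; rewrite edist_segment_point.
  have tc' : t <= c by apply: ub_le_sup; [case: Esup|split].
  rewrite -/c in tc; rewrite ler0_norm; last lra.
  apply: (@le_lt_trans _ _ ((c - t) * (edist x y + 1))).
    by rewrite opprB ler_wpM2l ?lerDl//; lra.
  by rewrite -ltr_pdivlMr// -/d; lra.
move=> Oc; have [e e0 ce] := domain_ball Oc.
have {}c1 : c < 1.
  rewrite lt_neqAle c1 andbT; apply/eqP => c1'; apply: ny.
  by rewrite -(segment_point1 x y) -c1'.
pose d := Num.min (1 - c) (e / (edist x y + 1) / 2).
have d0 : 0 < d by rewrite lt_min subr_gt0 c1 !divr_gt0.
have dle : d <= e / (edist x y + 1) / 2 by rewrite ge_min lexx orbT.
have dle1 : d <= 1 - c by rewrite ge_min lexx.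
suff : E (c + d) by move=> /(ub_le_sup Esup.2); rewrite -/c; lra.
split; [lra|lra|]; apply: ce; rewrite edist_segment_point.
rewrite addrAC subrr add0r (gtr0_norm d0).
apply: (@le_lt_trans _ _ (d * (edist x y + 1))).
  by rewrite ler_wpM2l ?lerDl ?ltW.
rewrite -ltr_pdivlMr//; have : 0 < e / (edist x y + 1) by rewrite divr_gt0.
lra.
Qed.

Lemma boundary_neq0 : boundary Omega !=set0.
Proof.
have [_ _ [x Ox] nT] := Omega_dom.
have [y ny] : exists y, ~ Omega y.
  apply: contrapT => h; apply: nT; apply/seteqP; split => // y _.
  by apply: contrapT => ny; apply: h; exists y.
by have [z bz _] := segment_crosses_boundary Ox ny; exists z.
Qed.

Lemma bdist_le x z : boundary Omega z -> bdist Omega x <= edist x z.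
Proof.
move=> bz; apply: ge_inf; last by exists z.
by exists 0 => _ [y _ <-]; exact: edist_ge0.
Qed.

Lemma bdist_ge x (r : R) :
  (forall z, boundary Omega z -> r <= edist x z) -> r <= bdist Omega x.
Proof.
move=> h; apply: lb_le_inf; last by move=> _ [z bz <-]; exact: h.
by have [z bz] := boundary_neq0; exists (edist x z); exists z.
Qed.

Lemma bdist_le_add x y : bdist Omega x <= bdist Omega y + edist x y.
Proof.
rewrite -lerBlDr; apply: bdist_ge => z bz; rewrite lerBlDr addrC.
exact: le_trans (bdist_le x bz) (edist_triangle _ _ _).
Qed.

Lemma bdist_gt0 x : Omega x -> 0 < bdist Omega x.
Proof.
move=> Ox; have [e e0 xe] := domain_ball Ox.
apply: (lt_le_trans e0); apply: bdist_ge => z /boundaryP[_ nz].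
by rewrite edistC leNgt; apply/negP => /xe.
Qed.

Lemma bdist_ball x y : Omega x -> edist x y < bdist Omega x -> Omega y.
Proof.
move=> Ox xy; apply: contrapT => ny.
have [z bz xz] := segment_crosses_boundary Ox ny.
by have := bdist_le x bz; lra.
Qed.

(** If [x] were not in the domain it would lie on the boundary, and the points
    that approach it would stay at distance at least [c] from it. *)
Lemma bdist_limit x (c : R) : 0 < c ->
  (forall e : R, 0 < e ->
    exists y, [/\ Omega y, c <= bdist Omega y & edist y x < e]) ->
  Omega x.
Proof.
move=> c0 cx; apply: contrapT => nx.
have bx : boundary Omega x.
  by apply/boundaryP; split=> // e /cx[y [Oy _ yx]]; exists y.
have [y [Oy cy yx]] := cx c c0.
by have := bdist_le y bx; lra.
Qed.

End BoundaryDistance.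

(** * Quasihyperbolic length of curves *)

Section QuasihyperbolicCurves.
Context {R : realType} {n : nat}.
Variable Omega : set 'rV[R]_n.
Hypothesis Omega_dom : domain Omega.
Implicit Types (x y z : 'rV[R]_n) (a b c l s t e : R) (g h : R -> 'rV[R]_n).

Notation k := (qh_dist Omega).

Definition qh_density z : R := (bdist Omega z)^-1.

Definition qh_length a b g : R := itv_int a b (qh_density \o g).

Definition qh_curve x y l g : Prop :=
  [/\ 0 <= l, unit_speed 0 l g, (forall t, 0 <= t -> t <= l -> Omega (g t)),
      g 0 = x & g l = y].

Lemma qh_density_ge0 z : Omega z -> 0 <= qh_density z.
Proof. by move=> Oz; rewrite invr_ge0 ltW// bdist_gt0. Qed.

Lemma qh_density_continuous a b g : unit_speed a b g ->
  (forall t, a <= t -> t <= b -> Omega (g t)) ->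
  {within `[a, b], continuous (qh_density \o g)}.
Proof.
move=> ug Og; apply/subspace_continuousP => c; rewrite /= in_itv/= => /andP[ac cb].
apply: cvgV; first by rewrite gt_eqF// bdist_gt0//; exact: Og.
apply/cvgrPdist_lt => e e0; apply/nbhs_ballP; exists e => //= t.
rewrite /ball/= in_itv/= => cte /andP[at_ tb].
have lip u v : a <= u -> u <= v -> v <= b ->
    `|bdist Omega (g u) - bdist Omega (g v)| <= v - u.
  move=> au uv vb; have := unit_speed_lip ug au uv vb.
  have := bdist_le_add Omega_dom (g u) (g v).
  have := bdist_le_add Omega_dom (g v) (g u).
  by rewrite (edistC (g v)) ler_norml => *; apply/andP; split; lra.
apply: le_lt_trans cte; have [ct|/ltW tc] := leP c t.
  by rewrite (le_trans (lip _ _ ac ct tb))// distrC ler_norm.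
by rewrite distrC (le_trans (lip _ _ at_ tc cb))// ler_norm.
Qed.

Lemma qh_curve_continuous x y l g : qh_curve x y l g ->
  {within `[0, l], continuous (qh_density \o g)}.
Proof. by case=> l0 ug Og _ _; exact: qh_density_continuous. Qed.

Lemma qh_length_ge0 x y l g : qh_curve x y l g -> 0 <= qh_length 0 l g.
Proof.
by case=> l0 ug Og _ _; apply: itv_int_ge0 => t t0 tl; exact/qh_density_ge0/Og.
Qed.

Lemma qh_curve_line_integral x y l g : qh_curve x y l g ->
  line_integral (fun z => (bdist Omega z)^-1) 0 l g = (qh_length 0 l g)%:E.
Proof.
move=> gxy; have [l0 ug Og _ _] := gxy.
rewrite /line_integral (curve_length_unit_speed ug)//= subr0.
rewrite /qh_length -itv_int_EFin; last exact: qh_curve_continuous gxy.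
apply: eq_integral => s; rewrite inE/= in_itv/= => /andP[s0 sl].
by rewrite (arclength_param_id ug)// ?subr0// add0r.
Qed.

(** Parametrisation by arclength replaces every competitor by a unit-speed one
    with the same integral.  From here on, the quasihyperbolic distance is an
    infimum over unit-speed curves [[0, l] -> Omega], for which the operations
    on curves are elementary. *)
Lemma qh_dist_setE x y :
  [set v | exists a b g, rectifiable_curve_in Omega x y a b g /\
    v = line_integral (fun z => (bdist Omega z)^-1) a b g] =
  [set v | exists l g, qh_curve x y l g /\ v = (qh_length 0 l g)%:E].
Proof.
apply/seteqP; split => v /=.
  move=> [a [b [g [[ab cg rg Og [gx gy]] ->]]]].
  have [uh h0 hl hg] := arclength_param_unit_speed ab rg cg.
  set l := fine _ in uh hl hg; set h := arclength_param _ _ _ in uh h0 hl hg.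
  have l0 : 0 <= l by rewrite fine_ge0// curve_length_ge0.
  have hxy : qh_curve x y l h.
    split; rewrite ?h0 ?hl// => s s0 sl.
    by have [t tab ->] := hg s s0 sl; exact: Og.
  exists l, h; split => //.
  rewrite /line_integral -itv_int_EFin//; exact: qh_curve_continuous hxy.
move=> [l [g [gxy ->]]]; exists 0, l, g.
split; last by rewrite (qh_curve_line_integral gxy).
have [l0 ug Og gx gy] := gxy; split => //.
- exact: unit_speed_continuous.
- by rewrite /rectifiable (curve_length_unit_speed ug)// ltry.
- by move=> t; rewrite in_itv/= => /andP[t0 tl]; exact: Og.
Qed.

Lemma qh_dist_le x y l g : qh_curve x y l g -> k x y <= qh_length 0 l g.
Proof.
move=> gxy; rewrite /qh_dist qh_dist_setE; set S := [set v | _].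
have Sg : S (qh_length 0 l g)%:E by exists l, g.
have S0 : (0 <= ereal_inf S)%E.
  by apply: le_ereal_inf_tmp => _ [l' [g' [g'xy ->]]]; rewrite lee_fin (qh_length_ge0 g'xy).
have Sle : (ereal_inf S <= (qh_length 0 l g)%:E)%E by exact: ereal_inf_lbound.
rewrite -lee_fin fineK// ge0_fin_numE//.
by rewrite (le_lt_trans Sle)// ltry.
Qed.

(** The concatenation is 1-Lipschitz, and the lengths of its two halves add up
    to the length of its parameter interval, so it has unit speed. *)
Lemma qh_curve_cat x y z l1 l2 g1 g2 :
  qh_curve x y l1 g1 -> qh_curve y z l2 g2 ->
  exists2 g, qh_curve x z (l1 + l2) g &
    qh_length 0 (l1 + l2) g = qh_length 0 l1 g1 + qh_length 0 l2 g2.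
Proof.
move=> [l10 u1 O1 g1x g1y] [l20 u2 O2 g2y g2z].
pose g t := if t <= l1 then g1 t else g2 (t - l1).
have gl t : t <= l1 -> g t = g1 t by rewrite /g => ->.
have gr t : l1 <= t -> g t = g2 (t - l1).
  rewrite /g le_eqVlt => /predU1P[<-|]; first by rewrite lexx subrr g1y g2y.
  by rewrite ltNge => /negbTE ->.
have lip s t : 0 <= s -> s <= t -> t <= l1 + l2 -> edist (g s) (g t) <= t - s.
  move=> s0 st tl; have [tl1|l1t] := leP t l1.
    by rewrite !gl//; [apply: (unit_speed_lip u1)|lra].
  have [l1s|sl1] := leP l1 s.
    rewrite !gr//; last exact: ltW.
    by apply: le_trans (unit_speed_lip u2 _ _ _) _; lra.
  apply: (le_trans (edist_triangle (g l1) _ _)).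
  have := unit_speed_lip u1 s0 (ltW sl1) (lexx l1).
  rewrite -!gl ?(ltW sl1)// => d1.
  have d2 : edist (g l1) (g t) <= t - l1.
    rewrite !gr ?(ltW l1t)// subrr.
    by apply: le_trans (unit_speed_lip u2 _ _ _) _; lra.
  lra.
have ug : unit_speed 0 (l1 + l2) g.
  apply: lip_unit_speed => //; first lra.
  rewrite (curve_length_add (c := l1)); [|lra..].
  rewrite subr0 EFinD; apply: leeD.
    rewrite -[l1 in leLHS]subr0 -(curve_length_unit_speed u1)//.
    apply: (curve_length_reparam (v := id)) => //.
    by move=> t _ tl; rewrite gl.
  rewrite -[l2 in leLHS]subr0 -(curve_length_unit_speed u2)//.
  have := @curve_length_reparam R n 0 l2 g2 g (fun t => l1 + t).
  rewrite addr0; apply => //.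
    by move=> *; lra.
  by move=> t t0 tl; rewrite gr ?lerDl// addrAC subrr add0r.
have Og t : 0 <= t -> t <= l1 + l2 -> Omega (g t).
  move=> t0 tl; have [tl1|/ltW l1t] := leP t l1; first by rewrite gl//; exact: O1.
  by rewrite gr//; apply: O2; lra.
have gxz : qh_curve x z (l1 + l2) g.
  split => //; [lra|by rewrite gl|].
  by rewrite gr ?lerDl// addrAC subrr add0r.
exists g => //; rewrite /qh_length (itv_int_add (c := l1)); last 3 first.
- exact: qh_curve_continuous gxz.
- by [].
- lra.
apply: (congr2 +%R); first by apply: eq_itv_int => t _ tl; rewrite /= gl.
have := @itv_int_shift R 0 l2 l1 (qh_density \o g) l20.
rewrite add0r (addrC l2) => <-; last first.
  by apply: within_sub (qh_curve_continuous gxz) _ _; lra.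
apply: eq_itv_int => t t0 tl; rewrite /= gr; last lra.
by rewrite addrK.
Qed.

Lemma qh_curve_rev x y l g : qh_curve x y l g ->
  exists2 h, qh_curve y x l h & qh_length 0 l h = qh_length 0 l g.
Proof.
move=> gxy; have [l0 ug Og gx gy] := gxy.
exists (fun t => g (- (t + - l))).
  split => //.
  - apply: lip_unit_speed => // [s t s0 st tl|].
      rewrite edistC; apply: le_trans (unit_speed_lip ug _ _ _) _; lra.
    rewrite -(curve_length_unit_speed ug)// curve_length_rev// oppr0.
    have := @curve_length_reparam R n (- l) 0 (g \o -%R) (fun t => g (- (t + - l)))
      (fun t => t + l).
    rewrite addNr add0r; apply; first lra.
      by move=> *; lra.
    by move=> t _ _; rewrite addrK.
  - by move=> t t0 tl; apply: Og; lra.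
  - by rewrite add0r opprK.
  - by rewrite subrr oppr0.
have cg := qh_curve_continuous gxy.
rewrite /qh_length.
have co : {within `[(0 - l), (l - l)], continuous (qh_density \o g \o -%R)}.
  rewrite sub0r subrr -oppr0.
  apply/subspace_continuousP => c /=; rewrite in_itv/= => /andP[c1 c2].
  apply: (@cvg_comp _ _ _ -%R (qh_density \o g) _ (within `[0, l]%classic (nbhs (- c)))).
    move=> A /nbhs_ballP[e /= e0 eA]; apply/nbhs_ballP; exists e => //= t.
    rewrite /ball/= in_itv/= => ct /andP[t1 t2]; apply: eA.
      by rewrite /ball/= -opprD normrN.
    by rewrite /= in_itv/=; apply/andP; split; lra.
  by move/subspace_continuousP : cg; apply; rewrite /= in_itv/=; apply/andP; split; lra.
apply: (etrans (itv_int_shift l0 co)).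
by rewrite sub0r subrr -(itv_int_opp l0 cg) oppr0.
Qed.

Lemma qh_dist_sub x y l g a b : qh_curve x y l g ->
  0 <= a -> a <= b -> b <= l -> k (g a) (g b) <= qh_length a b g.
Proof.
move=> gxy a0 ab bl; have [l0 ug Og _ _] := gxy.
have cg : {within `[a, b], continuous (qh_density \o g)}.
  exact: within_sub (qh_curve_continuous gxy) a0 bl.
have -> : qh_length a b g = qh_length 0 (b - a) (fun t => g (t + a)).
  rewrite /qh_length; have := @itv_int_shift R 0 (b - a) a (qh_density \o g).
  by rewrite add0r subrK subr_ge0 => /(_ ab cg) ->.
apply: qh_dist_le; split; rewrite ?add0r ?subrK ?subr_ge0//; last first.
  by move=> t t0 tb; apply: Og; lra.
apply: lip_unit_speed => [|s t s0 st tl|]; first by rewrite subr_ge0.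
  by apply: le_trans (unit_speed_lip ug _ _ _) _; lra.
rewrite subr0 -(ug a b)//.
have := @curve_length_reparam R n a b g (fun t => g (t + a)) (fun t => t - a).
rewrite subrr; apply => //; first by move=> *; lra.
by move=> t _ _; rewrite subrK.
Qed.

Lemma qh_curve_segment x y : Omega x -> edist x y < bdist Omega x ->
  exists2 g, qh_curve x y (edist x y) g &
    forall t, 0 <= t -> t <= edist x y ->
      bdist Omega x - edist x y <= bdist Omega (g t).
Proof.
move=> Ox xy; set d := edist x y in xy *.
have d0 : 0 <= d by exact: edist_ge0.
pose g t := segment_point x y (t / d).
have gl s t : 0 <= s -> s <= t -> t <= d -> edist (g s) (g t) <= t - s.
  move=> s0 st td; rewrite edist_segment_point -/d -mulrBl normrM.
  have [->|dn0] := eqVneq d 0; first by rewrite mulr0; lra.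
  rewrite (ger0_norm (x := d^-1)) ?invr_ge0// divfK// distrC ger0_norm//; lra.
have g0 : g 0 = x by rewrite /g mul0r segment_point0.
have gd : g d = y.
  rewrite /g; have [d00|dn0] := eqVneq d 0; last by rewrite divff// segment_point1.
  rewrite d00 mul0r segment_point0; exact: edist_eq0 d00.
have dg t : 0 <= t -> t <= d -> edist x (g t) <= d.
  by move=> t0 td; rewrite -{1}g0; have := gl 0 t (lexx 0) t0 td; lra.
exists g; last first.
  move=> t t0 td; have := bdist_le_add Omega_dom x (g t); have := dg t t0 td; lra.
split => //; last first.
  by move=> t t0 td; apply: (bdist_ball Omega_dom Ox); have := dg t t0 td; lra.
apply: lip_unit_speed => //; rewrite subr0.
by have := edist_le_length g d0; rewrite g0 gd.
Qed.

(** The set of points reached by such curves from [x] is open and closed in the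
    domain, because a point closer to [z] than the boundary can be joined to
    [z] by a segment. *)
Lemma qh_curve_exists x y : Omega x -> Omega y -> exists l g, qh_curve x y l g.
Proof.
move=> Ox; pose B := [set z | Omega z /\ exists l g, qh_curve x z l g].
have [Oo Oc _ _] := Omega_dom.
have step z w : B z -> edist z w < bdist Omega z -> B w.
  move=> [Oz [l [g gxz]]] zw; have [h hzw _] := qh_curve_segment Oz zw.
  have [h' hxw _] := qh_curve_cat gxz hzw.
  split; first exact: bdist_ball zw.
  by exists (l + edist z w), h'.
suff <- : B = Omega by case.
apply: Oc.
- exists x; split => //.
  have [|g gxx _] := @qh_curve_segment x x Ox; first by rewrite edistxx bdist_gt0.
  by exists (edist x x), g.
- exists B; last by apply/seteqP; split => z [] // ? ?.
  rewrite openE => z Bz; apply/nbhs_edistP.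
  exists (bdist Omega z); first by apply: bdist_gt0 => //; case: Bz.
  by move=> w wz; apply: step Bz _; rewrite edistC.
- exists (closure B); first exact: closed_closure.
  apply/seteqP; split => [z Bz|z [Oz cBz]].
    by split; [case: Bz|exact: subset_closure].
  have z0 := bdist_gt0 Omega_dom Oz.
  have /cBz[w [Bw wz]] : nbhs z [set w | edist w z < bdist Omega z / 2].
    by apply/nbhs_edistP; exists (bdist Omega z / 2) => //; lra.
  apply: step Bw _; have := bdist_le_add Omega_dom z w.
  by rewrite /= (edistC z) in wz *; lra.
Qed.

Lemma qh_dist_approx x y e : Omega x -> Omega y -> 0 < e ->
  exists l g, qh_curve x y l g /\ qh_length 0 l g < k x y + e.
Proof.
move=> Ox Oy e0; have [l0 [g0 gxy0]] := qh_curve_exists Ox Oy.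
rewrite /qh_dist qh_dist_setE; set S := [set v | _].
have Sg : S (qh_length 0 l0 g0)%:E by exists l0, g0.
have S0 : (0 <= ereal_inf S)%E.
  by apply: le_ereal_inf_tmp => _ [l' [g' [g'xy ->]]]; rewrite lee_fin (qh_length_ge0 g'xy).
have Sle : (ereal_inf S <= (qh_length 0 l0 g0)%:E)%E by exact: ereal_inf_lbound.
have Sfin : ereal_inf S \is a fin_num.
  by rewrite ge0_fin_numE// (le_lt_trans Sle)// ltry.
have [_ [l [g [gxy ->]]] lt] := lb_ereal_inf_adherent e0 Sfin.
by exists l, g; split=> //; rewrite -lte_fin EFinD (fineK Sfin).
Qed.

End QuasihyperbolicCurves.

(** * Sequences and ultralimits *)

Lemma strictly_increasing_ge (psi : nat -> nat) m :
  strictly_increasing psi -> (m <= psi m)%N.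
Proof.
move=> psiS; elim: m => // m IH; exact: leq_ltn_trans IH (psiS _ _ _).
Qed.

Lemma nat_above (R : realType) (M : R) :
  exists N, forall m, (N <= m)%N -> M < m%:R.
Proof.
exists (Num.bound (Num.max 0 M)) => m Nm.
have b0 : 0 <= Num.max 0 M by rewrite le_max lexx.
have := archi_boundP b0; rewrite gt_max => /andP[_ /lt_le_trans]; apply.
by rewrite ler_nat.
Qed.

Lemma inv_succ_small (R : realType) (e : R) : 0 < e ->
  exists N, forall m, (N <= m)%N -> m.+1%:R^-1 < e.
Proof.
move=> e0; have [N hN] := nat_above e^-1; exists N => m Nm.
by rewrite invf_plt ?posrE// hN// leqW.
Qed.

Lemma free_ultrafilter :
  exists G : set_system nat, UltraFilter G /\ forall N, G [set m | (N <= m)%N].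
Proof.
have [G [GU sG]] := @ultraFilterLemma _ (\oo : set_system nat) _.
by exists G; split => // N; apply: sG; exists N.
Qed.

(** Ultralimits replace extractions of subsequences: one ultrafilter serves
    countably or uncountably many sequences at the same time. *)
Lemma compact_ultralimit (I : Type) (T : topologicalType) (G : set_system I)
    (A : set T) (u : I -> T) : UltraFilter G -> compact A ->
  G [set i | A (u i)] ->
  exists2 p, A p & forall W, nbhs p W -> G [set i | W (u i)].
Proof.
move=> GU cA GA; have GF : ProperFilter (u @ G) by exact: fmap_proper_filter.
have [p [Ap clp]] := cA _ GF GA; exists p => // W pW.
have [//|GnW] := in_ultra_setVsetC (u @^-1` W) GU.
by have [y [nWy Wy]] := clp (~` W) W GnW pW.
Qed.

(** * The quasihyperbolic metric is proper *)

Section QuasihyperbolicMetric.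
Context {R : realType} {n : nat}.
Variable Omega : set 'rV[R]_n.
Hypothesis Omega_dom : domain Omega.
Hypothesis Omega_bdd : bounded_set Omega.
Implicit Types (x y z o : 'rV[R]_n) (a b c l s t e r : R) (g h : R -> 'rV[R]_n).

Notation k := (qh_dist Omega).

Lemma qh_dist_ge0 x y : Omega x -> Omega y -> 0 <= k x y.
Proof.
move=> Ox Oy; apply/ler_addgt0Pr => e e0.
have [l [g [gxy lt]]] := qh_dist_approx Omega_dom Ox Oy e0.
exact: le_trans (qh_length_ge0 Omega_dom gxy) (ltW lt).
Qed.

Lemma qh_distxx x : Omega x -> k x x = 0.
Proof.
move=> Ox; apply/le_anti; rewrite qh_dist_ge0// andbT.
have [|g gxx _] := @qh_curve_segment _ _ _ Omega_dom x x Ox.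
  by rewrite edistxx bdist_gt0.
by have := qh_dist_le Omega_dom gxx; rewrite edistxx /qh_length itv_intxx.
Qed.

Lemma qh_distC x y : Omega x -> Omega y -> k x y = k y x.
Proof.
have half u v : Omega u -> Omega v -> k u v <= k v u.
  move=> Ou Ov; apply/ler_addgt0Pr => e e0.
  have [l [g [gvu lt]]] := qh_dist_approx Omega_dom Ov Ou e0.
  have [h huv lh] := qh_curve_rev Omega_dom gvu.
  by apply: le_trans (qh_dist_le Omega_dom huv) _; rewrite lh ltW.
by move=> Ox Oy; apply/le_anti; rewrite !half.
Qed.

Lemma qh_dist_triangle y x z : Omega x -> Omega y -> Omega z ->
  k x z <= k x y + k y z.
Proof.
move=> Ox Oy Oz; apply/ler_addgt0Pr => e e0.
have e20 : 0 < e / 2 by lra.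
have [l [g [gxy lg]]] := qh_dist_approx Omega_dom Ox Oy e20.
have [m [h [hyz lh]]] := qh_dist_approx Omega_dom Oy Oz e20.
have [f fxz lf] := qh_curve_cat Omega_dom gxy hyz.
apply: le_trans (qh_dist_le Omega_dom fxz) _.
by rewrite lf (splitr e) addrACA lerD// ltW.
Qed.

(** On the segment the boundary distance is at least [bdist Omega x - edist x y]. *)
Lemma qh_dist_segment x y : Omega x -> edist x y < bdist Omega x ->
  k x y <= edist x y / (bdist Omega x - edist x y).
Proof.
move=> Ox xy; have [g gxy bg] := qh_curve_segment Omega_dom Ox xy.
apply: (le_trans (qh_dist_le Omega_dom gxy)).
rewrite mulrC -{3}(subr0 (edist x y)) -itv_int_cst ?edist_ge0//.
apply: itv_int_le => [||t t0 tl]; first exact: qh_curve_continuous gxy.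
  by apply: continuous_subspaceT => ?; exact: cvg_cst.
by rewrite lef_pV2 ?posrE ?bg ?subr_gt0// (lt_le_trans _ (bg t t0 tl))// subr_gt0.
Qed.

Lemma qh_dist_near x e : Omega x -> 0 < e ->
  exists2 d : R, 0 < d & forall y, edist x y < d -> Omega y /\ k x y < e.
Proof.
move=> Ox e0; have d0 := bdist_gt0 Omega_dom Ox; set d := bdist Omega x in d0.
pose m := Num.min (d / 2) (e * d / 4).
have m0 : 0 < m by rewrite lt_min; apply/andP; split; [lra|rewrite !mulr_gt0//; lra].
exists m => // y; rewrite lt_min => /andP[y1 y2].
have xy : edist x y < bdist Omega x by rewrite -/d; lra.
split; first exact: bdist_ball xy.
apply: (le_lt_trans (qh_dist_segment Ox xy)).
rewrite -/d ltr_pdivrMr; last lra.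
by apply: (lt_le_trans y2); rewrite -mulrA ler_wpM2l//; lra.
Qed.

(** Along a unit-speed curve starting at [x], the boundary distance at time [s]
    is at most [bdist Omega x + s]. *)
Lemma qh_dist_lower_log x y : Omega x -> Omega y ->
  ln (1 + edist x y / bdist Omega x) <= k x y.
Proof.
move=> Ox Oy; have d0 := bdist_gt0 Omega_dom Ox; set d := bdist Omega x in d0 *.
apply/ler_addgt0Pr => e e0.
have [l [g [gxy lt]]] := qh_dist_approx Omega_dom Ox Oy e0.
apply: le_trans (ltW lt).
have [l0 ug Og gx gy] := gxy.
have xyl : edist x y <= l.
  by have := unit_speed_lip ug (lexx 0) l0 (lexx l); rewrite gx gy subr0.
apply: (@le_trans _ _ (ln (1 + l / d))).
  rewrite ler_ln ?posrE ?lerD2l ?ler_pM2r ?invr_gt0//.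
    by rewrite ltr_pwDl// divr_ge0 ?edist_ge0// ltW.
  by rewrite ltr_pwDl// divr_ge0// ltW.
rewrite -itv_int_inv//; apply: itv_int_le => [||t t0 tl].
- apply: continuous_in_subspaceT => t; rewrite inE/= in_itv/= => /andP[t0 tl].
  apply: cvgV; first by apply: lt0r_neq0; lra.
  by apply: cvgD; [exact: cvg_cst|exact: cvg_id].
- exact: qh_curve_continuous gxy.
- rewrite lef_pV2 ?posrE; last 2 first.
  + by lra.
  + by apply: bdist_gt0 => //; exact: Og.
  have := bdist_le_add Omega_dom (g t) x; rewrite -/d -gx edistC => /le_trans; apply.
  by rewrite lerD2l; have := unit_speed_lip ug (lexx 0) t0 tl; rewrite subr0.
Qed.

Lemma bounded_domain_norm : exists2 M : R, 0 < M & forall x, Omega x -> `|x| <= M.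
Proof.
have [M [_ hM]] := Omega_bdd.
exists (Num.max 1 (M + 1)); first by rewrite lt_max ltr01.
by move=> x Ox; apply: hM => //; rewrite lt_max ltrDl ltr01 orbT.
Qed.

(** In a bounded domain the boundary distance is bounded above, so the density
    is bounded below. *)
Lemma edist_le_qh_dist :
  exists2 D : R, 0 < D & forall x y, Omega x -> Omega y -> edist x y <= D * k x y.
Proof.
have [M M0 hM] := bounded_domain_norm.
have [z bz] := boundary_neq0 Omega_dom.
pose D := n%:R * (M + `|z|) + 1.
have D0 : 0 < D by rewrite ltr_wpDl// mulr_ge0// addr_ge0// ltW.
have bD x : Omega x -> bdist Omega x <= D.
  move=> Ox; apply: (le_trans (bdist_le x bz)).
  apply: (le_trans (edist_le_norm x z)); rewrite ler_wpDr// ler_wpM2l//.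
  by rewrite (le_trans (ler_normB _ _))// lerD2r hM.
exists D => // x y Ox Oy; rewrite mulrC -ler_pdivrMr//.
apply/ler_addgt0Pr => e e0.
have [l [g [gxy lt]]] := qh_dist_approx Omega_dom Ox Oy e0.
apply: le_trans (ltW lt).
have [l0 ug Og gx gy] := gxy.
have xyl : edist x y <= l.
  by have := unit_speed_lip ug (lexx 0) l0 (lexx l); rewrite gx gy subr0.
apply: (@le_trans _ _ (D^-1 * (l - 0))).
  by rewrite mulrC subr0 ler_pM2l ?invr_gt0.
rewrite -itv_int_cst//; apply: itv_int_le => [||t t0 tl].
- by apply: continuous_subspaceT => ?; exact: cvg_cst.
- exact: qh_curve_continuous gxy.
- by rewrite lef_pV2 ?posrE ?bD//; [exact: Og|apply: bdist_gt0 => //; exact: Og].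
Qed.

(** The logarithmic lower bound, with [x] near the boundary and [y] fixed. *)
Lemma bdist_ge_qh_ball o r : Omega o ->
  exists2 c : R, 0 < c & forall x, Omega x -> k o x <= r -> c <= bdist Omega x.
Proof.
move=> Oo; have o0 := bdist_gt0 Omega_dom Oo.
exists (bdist Omega o / expR r); first by rewrite divr_gt0 ?expR_gt0.
move=> x Ox; have x0 := bdist_gt0 Omega_dom Ox.
rewrite qh_distC// => kr.
have := le_trans (qh_dist_lower_log Ox Oo) kr.
have p : 0 < 1 + edist x o / bdist Omega x.
  by rewrite ltr_pwDl// divr_ge0 ?edist_ge0// ltW.
rewrite -ler_expR lnK ?posrE// => h.
rewrite ler_pdivrMr ?expR_gt0// mulrC.
have : bdist Omega x + edist x o <= expR r * bdist Omega x.
  rewrite -ler_pdivrMr// mulrDl divff//; exact: lt0r_neq0.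
by have := bdist_le_add Omega_dom o x; rewrite edistC; lra.
Qed.

(** On a ball the boundary distance is bounded below, so that no Euclidean limit
    point lies on the boundary. *)
Lemma qh_ball_compact o r : Omega o -> compact [set x | Omega x /\ k o x <= r].
Proof.
move=> Oo; apply: bounded_closed_compact.
  have [M [Mr hM]] := Omega_bdd; exists M; split=> // N MN x [Ox _].
  exact: (hM N).
move=> y cy; have [c c0 hc] := bdist_ge_qh_ball r Oo.
have near e : 0 < e -> exists x, [/\ Omega x, k o x <= r & edist x y < e].
  move=> e0; have /cy[x [[Ox kx] xy]] : nbhs y [set x | edist x y < e].
    by apply/nbhs_edistP; exists e.
  by exists x.
have Oy : Omega y.
  apply: (bdist_limit Omega_dom c0) => e /near[x [Ox kx xy]].
  by exists x; split => //; exact: hc.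
split=> //; apply/ler_addgt0Pr => e e0.
have [d d0 hd] := qh_dist_near Oy e0.
have [x [Ox kx xy]] := near d d0.
have [|_ kyx] := hd x; first by rewrite edistC.
by have := qh_dist_triangle Oo Ox Oy; rewrite (qh_distC Ox Oy); lra.
Qed.

Lemma qh_proper (I : Type) (G : set_system I) o r (u : I -> 'rV[R]_n) :
  UltraFilter G -> Omega o -> G [set i | Omega (u i) /\ k o (u i) <= r] ->
  exists2 x, Omega x & forall e, 0 < e -> G [set i | k (u i) x < e].
Proof.
move=> GU Oo Gu.
have [x [Ox kx] xu] := compact_ultralimit GU (qh_ball_compact Oo) Gu.
exists x => // e e0; have [d d0 hd] := qh_dist_near Ox e0.
have Gd : G [set i | edist (u i) x < d].
  by apply: (xu [set y | edist y x < d]); apply/nbhs_edistP; exists d.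
apply: filterS Gd => i /=; rewrite edistC => /hd[Oi].
by rewrite qh_distC.
Qed.

Lemma qh_dist_eq0 x y : Omega x -> Omega y -> k x y = 0 -> x = y.
Proof.
move=> Ox Oy xy0; have [D D0 hD] := edist_le_qh_dist.
apply: edist_eq0; apply/le_anti; rewrite edist_ge0 andbT.
by have := hD x y Ox Oy; rewrite xy0 mulr0.
Qed.

End QuasihyperbolicMetric.

(** * Quasihyperbolic geodesics *)

Section QuasihyperbolicGeodesics.
Context {R : realType} {n : nat}.
Variable Omega : set 'rV[R]_n.
Hypothesis Omega_dom : domain Omega.
Hypothesis Omega_bdd : bounded_set Omega.
Implicit Types (x y z o : 'rV[R]_n) (a b c l s t e r : R) (g h : R -> 'rV[R]_n).

Notation k := (qh_dist Omega).

(** An almost shortest curve, reparametrised by its quasihyperbolic length: the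
    distance between two of its points is at most the length of the arc between
    them. *)
Lemma almost_geodesic x y e : Omega x -> Omega y -> 0 < e ->
  exists z : R -> 'rV[R]_n,
  [/\ forall s, 0 <= s -> s <= k x y -> Omega (z s),
      forall s t, 0 <= s -> s <= t -> t <= k x y -> k (z s) (z t) <= t - s,
      k x (z 0) <= 0 & k (z (k x y)) y < e].
Proof.
move=> Ox Oy e0; set D := k x y.
have D0 : 0 <= D by exact: qh_dist_ge0.
have [l [g [gxy lt]]] := qh_dist_approx Omega_dom Ox Oy e0.
have cg := qh_curve_continuous Omega_dom gxy.
have [l0 ug Og gx gy] := gxy.
pose f := qh_density Omega \o g.
have f0 t : 0 <= t -> t <= l -> 0 <= f t.
  by move=> t0 tl; apply/qh_density_ge0/Og.
have DI : D <= itv_int 0 l f by exact: qh_dist_le.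
have /choice[p hp] s : exists t, 0 <= s -> s <= D ->
    [/\ 0 <= t, t <= l & itv_int 0 t f = s].
  have [s0|] := leP 0 s; last by exists 0.
  have [sD|] := leP s D; last by exists 0.
  by have [t ht] := itv_int_IVT l0 cg s0 (le_trans sD DI); exists t.
have sub s t : 0 <= s -> s <= t -> t <= D -> p s <= p t ->
    k (g (p s)) (g (p t)) <= t - s.
  move=> s0 st tD pst.
  have [ps0 psl ps] := hp s s0 (le_trans st tD).
  have [pt0 ptl pt] := hp t (le_trans s0 st) tD.
  apply: (le_trans (qh_dist_sub Omega_dom gxy ps0 pst ptl)).
  have := itv_int_add (within_sub cg (lexx 0) ptl) ps0 pst.
  by rewrite -/f ps pt /qh_length -/f; lra.
exists (g \o p); split => /=.
- by move=> s s0 sD; have [ps0 psl _] := hp s s0 sD; exact: Og.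
- move=> s t s0 st tD; have [pst|pts] := leP (p s) (p t); first exact: sub.
  have [ps0 psl ps] := hp s s0 (le_trans st tD).
  have [pt0 ptl pt] := hp t (le_trans s0 st) tD.
  have := itv_int_add (within_sub cg (lexx 0) psl) pt0 (ltW pts).
  rewrite -/f ps pt => sE.
  have : 0 <= itv_int (p t) (p s) f.
    by apply: itv_int_ge0 => u ? ?; apply: f0; lra.
  move=> I0; have ts : t = s by lra.
  by rewrite ts subrr qh_distxx//; exact: Og.
- have [p0 pl pE] := hp 0 (lexx 0) D0.
  have := qh_dist_sub Omega_dom gxy (lexx 0) p0 pl.
  by rewrite gx /qh_length -/f pE.
- have [p0 pl pE] := hp D D0 (lexx D).
  have := qh_dist_sub Omega_dom gxy p0 pl (lexx l).
  have := itv_int_add cg p0 pl; rewrite -/f pE gy; move: lt.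
  by rewrite /qh_length -/f -/D; lra.
Qed.

(** By properness, almost geodesics have a pointwise ultralimit.  It is
    1-Lipschitz and defined on an interval of length [k x y], so the triangle
    inequality leaves no slack. *)
Lemma qh_geodesic_exists x y : Omega x -> Omega y ->
  exists g, geodesic_from_to Omega k x y (k x y) g.
Proof.
move=> Ox Oy; set D := k x y.
have D0 : 0 <= D by exact: qh_dist_ge0.
have [G [GU Gfree]] := free_ultrafilter.
have /choice[z hz] (m : nat) : exists z : R -> 'rV[R]_n,
    [/\ forall s, 0 <= s -> s <= D -> Omega (z s),
        forall s t, 0 <= s -> s <= t -> t <= D -> k (z s) (z t) <= t - s,
        k x (z 0) <= 0 & k (z D) y < m.+1%:R^-1].
  by apply: almost_geodesic => //; rewrite invr_gt0.
have /choice[g hg] s : exists w, 0 <= s -> s <= D ->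
    Omega w /\ forall e, 0 < e -> G [set m | k (z m s) w < e].
  have [s0|] := leP 0 s; last by exists x.
  have [sD|] := leP s D; last by exists x.
  have [|w Ow hw] := @qh_proper _ _ _ Omega_dom Omega_bdd nat G x D (z ^~ s) GU Ox.
    apply: filterS filterT => m _ /=.
    have [hO hlip hx _] := hz m; split; first exact: hO.
    have := hlip 0 s (lexx 0) s0 sD.
    have := qh_dist_triangle Omega_dom Ox (hO 0 (lexx 0) D0) (hO s s0 sD); lra.
  by exists w.
have Og s : 0 <= s -> s <= D -> Omega (g s) by move=> s0 sD; case: (hg s s0 sD).
have lip s t : 0 <= s -> s <= t -> t <= D -> k (g s) (g t) <= t - s.
  move=> s0 st tD; have sD := le_trans st tD; have t0 := le_trans s0 st.
  apply/ler_addgt0Pr => e e0; have e2 : 0 < e / 2 by lra.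
  have [m [/= h1 h2]] :=
    filter_ex (filterI ((hg s s0 sD).2 _ e2) ((hg t t0 tD).2 _ e2)).
  have [hO hlip _ _] := hz m.
  have Os := Og s s0 sD; have Ot := Og t t0 tD.
  have := qh_dist_triangle Omega_dom Os (hO s s0 sD) Ot.
  have := qh_dist_triangle Omega_dom (hO s s0 sD) (hO t t0 tD) Ot.
  have := hlip s t s0 st tD.
  by rewrite (qh_distC Omega_dom Os (hO s s0 sD)); lra.
have gx : g 0 = x.
  apply: (qh_dist_eq0 Omega_dom Omega_bdd) => //; first exact: Og.
  apply/le_anti; rewrite (qh_dist_ge0 Omega_dom (Og 0 (lexx 0) D0) Ox) andbT.
  apply/ler_addgt0Pr => e e0; have [m /= h1] := filter_ex ((hg 0 (lexx 0) D0).2 _ e0).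
  have [hO _ hx _] := hz m; have O0 := hO 0 (lexx 0) D0.
  have := qh_dist_triangle Omega_dom Ox O0 (Og 0 (lexx 0) D0).
  by rewrite (qh_distC Omega_dom Ox (Og 0 (lexx 0) D0)); lra.
have gy : g D = y.
  have OD := Og D D0 (lexx D).
  apply: (qh_dist_eq0 Omega_dom Omega_bdd) => //.
  apply/le_anti; rewrite (qh_dist_ge0 Omega_dom OD Oy) andbT.
  apply/ler_addgt0Pr => e e0; have e2 : 0 < e / 2 by lra.
  have [N hN] := inv_succ_small e2.
  have [m [/= h1 /hN h2]] := filter_ex (filterI ((hg D D0 (lexx D)).2 _ e2) (Gfree N)).
  have [hO _ _ hy] := hz m.
  have OzD := hO D D0 (lexx D).
  have := qh_dist_triangle Omega_dom OD OzD Oy; have := lt_trans hy h2.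
  by rewrite (qh_distC Omega_dom OD OzD); move: h1; clear; lra.
have eqd s t : 0 <= s -> s <= t -> t <= D -> k (g s) (g t) = t - s.
  move=> s0 st tD; have sD := le_trans st tD; have t0 := le_trans s0 st.
  apply/le_anti; rewrite lip//=.
  have := qh_dist_triangle Omega_dom Ox (Og s s0 sD) Oy.
  have := qh_dist_triangle Omega_dom (Og s s0 sD) (Og t t0 tD) Oy.
  have := lip 0 s (lexx 0) s0 sD; have := lip t D t0 tD (lexx D).
  by rewrite gx gy -/D; lra.
exists g; split => //; split => //.
  by move=> t /andP[t0 tD]; exact: Og.
move=> s t /andP[s0 sD] /andP[t0 tD].
have [st|/ltW ts] := leP s t.
  by rewrite eqd// ler0_norm; lra.
rewrite (qh_distC Omega_dom (Og s s0 sD) (Og t t0 tD)) eqd// ger0_norm; lra.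
Qed.

End QuasihyperbolicGeodesics.

(** * Rays in proper geodesic spaces *)

Section GromovCompactification.
Context {R : realType} {V : Type}.
Variables (X : set V) (d : V -> V -> R).
Implicit Types (x y z o : V) (g h : R -> V) (c : nat -> R -> V) (s t e T : R).

Definition metric_on : Prop :=
  [/\ forall x, X x -> d x x = 0, forall x y, X x -> X y -> d x y = d y x &
      forall y x z, X x -> X y -> X z -> d x z <= d x y + d y z].

(** Properness, in the form in which it is used: bounded sequences have
    ultralimits. *)
Definition proper_on : Prop :=
  forall (G : set_system nat) o r (u : nat -> V), UltraFilter G -> X o ->
  G [set m | X (u m) /\ d o (u m) <= r] ->
  exists2 x, X x & forall e : R, 0 < e -> G [set m | d (u m) x < e].

Definition geodesic_on : Prop :=
  forall x y, X x -> X y -> exists g, geodesic_from_to X d x y (d x y) g.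

Hypothesis dmetric : metric_on.

Let dxx x : X x -> d x x = 0. Proof. by case: dmetric => dxx _ _; exact: dxx. Qed.
Let dC x y : X x -> X y -> d x y = d y x.
Proof. by case: dmetric => _ dC _; exact: dC. Qed.
Let dtri y x z : X x -> X y -> X z -> d x z <= d x y + d y z.
Proof. by case: dmetric => _ _ dtri; exact: dtri. Qed.

(** The common properties of geodesic rays and of geodesic segments extended by
    a constant, which are all that compactness arguments need. *)
Definition lipschitz_from o g : Prop :=
  [/\ g 0 = o, forall t, 0 <= t -> X (g t) &
      forall s t, 0 <= s -> s <= t -> d (g s) (g t) <= t - s].

Lemma geodesic_ray_lipschitz o g : geodesic_ray X d o g -> lipschitz_from o g.
Proof.
move=> [g0 gX gd]; split=> // s t s0 st.
by rewrite gd ?(le_trans s0)// distrC ger0_norm// subr_ge0.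
Qed.

Lemma geodesic_from_to_dist o x T g t : geodesic_from_to X d o x T g ->
  0 <= t -> t <= T -> d o (g t) = t.
Proof.
move=> [[T0 _ gd] g0 _] t0 tT.
by rewrite -g0 gd ?lexx ?T0 ?t0// sub0r normrN ger0_norm.
Qed.

Lemma geodesic_from_to_lipschitz o x T g : geodesic_from_to X d o x T g ->
  (forall t, T <= t -> g t = x) -> lipschitz_from o g.
Proof.
move=> [[T0 gX gd] g0 gT] gx.
have Xx : X x by rewrite -gT; apply: gX; rewrite T0 lexx.
have dE s t : 0 <= s -> s <= t -> t <= T -> d (g s) (g t) = t - s.
  move=> s0 st tT; rewrite gd ?s0 ?(le_trans st)// ?(le_trans s0)//.
  by rewrite distrC ger0_norm// subr_ge0.
split=> // [t t0|s t s0 st].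
  have [tT|/ltW/gx->//] := leP t T; by apply: gX; rewrite t0.
have [tT|/ltW Tt] := leP t T; first by rewrite dE.
rewrite (gx t Tt); have [sT|/ltW Ts] := leP s T; last first.
  by rewrite (gx s Ts) dxx//; lra.
by rewrite -gT dE//; lra.
Qed.

Lemma ideal_ray o (C : gromov_boundary X d o) g :
  sval C g -> geodesic_ray X d o g.
Proof. by case: C => C [h _ /= ->] []. Qed.

Lemma generalized_ray_lipschitz o (p : gromov_closure X d o) g :
  generalized_ray p g -> lipschitz_from o g.
Proof.
case: p => [[x Xx]|C] /=.
  by move=> [T [gx]]; exact: geodesic_from_to_lipschitz.
by move=> /ideal_ray; exact: geodesic_ray_lipschitz.
Qed.

Definition stopped g T : R -> V := fun t => g (Num.min t T).

Lemma stopped_geodesic x y T g : geodesic_from_to X d x y T g ->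
  geodesic_from_to X d x y T (stopped g T) /\
  forall t, T <= t -> stopped g T t = y.
Proof.
move=> [[T0 gX gd] g0 gT].
have gE t : t <= T -> stopped g T t = g t by move=> tT; rewrite /stopped min_l.
split; last by move=> t Tt; rewrite /stopped min_r.
split; rewrite ?gE//; split => // [t /andP[t0 tT]|s t /andP[s0 sT] /andP[t0 tT]].
  by rewrite gE//; apply: gX; rewrite t0.
by rewrite !gE// gd ?s0 ?t0.
Qed.

Lemma geodesic_rev x y T g : geodesic_from_to X d x y T g ->
  geodesic_from_to X d y x T (fun t => g (T - t)).
Proof.
move=> [[T0 gX gd] g0 gT].
split; rewrite ?subr0 ?subrr//; split => // [t /andP[t0 tT]|].
  by apply: gX; apply/andP; split; lra.
move=> s t /andP[s0 sT] /andP[t0 tT].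
rewrite gd; [|by apply/andP; split; lra..].
by rewrite [RHS]distrC; congr `|_|; ring.
Qed.

Lemma geodesic_sub T g a b : geodesic X d T g -> 0 <= a -> a <= b -> b <= T ->
  geodesic X d (b - a) (fun t => g (a + t)).
Proof.
move=> [T0 gX gd] a0 ab bT; split => [|t /andP[t0 tb]|s t /andP[s0 sb] /andP[t0 tb]].
- by rewrite subr_ge0.
- by apply: gX; apply/andP; split; lra.
- rewrite gd; [|by apply/andP; split; lra..].
  by congr `|_|; ring.
Qed.

Lemma geodesic_ray_geodesic o g T : geodesic_ray X d o g -> 0 <= T ->
  geodesic X d T g.
Proof.
move=> [g0 gX gd] T0; split => // [t /andP[t0 _]|s t /andP[s0 _] /andP[t0 _]].
  exact: gX.
exact: gd.
Qed.

Lemma filter_forall_lt (G : set_system nat) (P : nat -> set nat) N :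
  Filter G -> (forall i, G (P i)) ->
  G [set m | forall i, (i < N)%N -> P i m].
Proof.
move=> GF GP; elim: N => [|N IH]; first by apply: filterS filterT.
apply: filterS (filterI IH (GP N)) => m [hm PN] i.
by rewrite ltnS leq_eqVlt => /predU1P[->//|]; exact: hm.
Qed.

(** The limit is a pointwise ultralimit; the [j]-th term of the
    subsequence is chosen close to it on the grid of mesh [1 / (j + 1)] in
    [0, j + 1], and the Lipschitz bound controls the points between. *)
Lemma arzela_ascoli o c : proper_on -> X o ->
  (forall m, lipschitz_from o (c m)) ->
  exists psi g, [/\ strictly_increasing psi, g 0 = o,
    forall t, 0 <= t -> X (g t) & cvg_on_compacts d (c \o psi) g].
Proof.
move=> dproper Xo cl.
have cX m t : 0 <= t -> X (c m t) by move=> t0; case: (cl m) => _ + _; apply.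
have c0 m : c m 0 = o by case: (cl m).
have clip m s t : 0 <= s -> s <= t -> d (c m s) (c m t) <= t - s.
  by case: (cl m) => _ _; apply.
have [G [GU Gfree]] := free_ultrafilter.
have /choice[g hg] t : exists w, 0 <= t ->
    [/\ X w, t = 0 -> w = o & forall e, 0 < e -> G [set m | d (c m t) w < e]].
  have [->|t0] := eqVneq t 0.
    exists o => _; split => // e e0; apply: filterS filterT => m _ /=.
    by rewrite c0 dxx.
  have [t0'|] := leP 0 t; last by exists o.
  have [|w Xw hw] := dproper G o t (c ^~ t) GU Xo.
    apply: filterS filterT => m _ /=; split; first exact: cX.
    by have := clip m 0 t (lexx 0) t0'; rewrite c0 subr0.
  by exists w => _; split => // tt; rewrite tt eqxx in t0.
have gX t : 0 <= t -> X (g t) by move=> t0; case: (hg t t0).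
have g0 : g 0 = o by case: (hg 0 (lexx 0)) => _ + _; apply.
have glim t e : 0 <= t -> 0 < e -> G [set m | d (c m t) (g t) < e].
  by move=> t0 e0; case: (hg t t0) => _ _; apply.
have glip s t : 0 <= s -> s <= t -> d (g s) (g t) <= t - s.
  move=> s0 st; have t0 := le_trans s0 st.
  apply/ler_addgt0Pr => e e0; have e2 : 0 < e / 2 by lra.
  have [m [/= h1 h2]] := filter_ex (filterI (glim s _ s0 e2) (glim t _ t0 e2)).
  have := dtri (gX s s0) (cX m s s0) (gX t t0).
  have := dtri (cX m s s0) (cX m t t0) (gX t t0).
  have := clip m s t s0 st.
  by rewrite (dC (gX s s0) (cX m s s0)); lra.
pose grid (j i : nat) : R := i%:R / j.+1%:R.
have grid0 j i : 0 <= grid j i by rewrite divr_ge0.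
have /choice[f hf] (jN : nat * nat) : exists m, (jN.2 <= m)%N /\
    forall i, (i < (jN.1.+1 * jN.1.+1).+1)%N ->
      d (c m (grid jN.1 i)) (g (grid jN.1 i)) < jN.1.+1%:R^-1.
  case: jN => j N /=.
  have GA : G [set m | forall i, (i < (j.+1 * j.+1).+1)%N ->
      d (c m (grid j i)) (g (grid j i)) < j.+1%:R^-1].
    by apply: filter_forall_lt => i; apply: glim; rewrite ?invr_gt0.
  by have [m [h1 h2]] := filter_ex (filterI (Gfree N) GA); exists m.
pose psi := fix psi j := if j is i.+1 then f (j, (psi i).+1) else f (0%N, 0%N).
have psiS j : (psi j < psi j.+1)%N by exact: (hf (j.+1, (psi j).+1)).1.
have psi_grid j i : (i < (j.+1 * j.+1).+1)%N ->
    d (c (psi j) (grid j i)) (g (grid j i)) < j.+1%:R^-1.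
  by case: j => [|j]; [exact: (hf (0%N, 0%N)).2|exact: (hf (j.+1, (psi j).+1)).2].
exists psi, g; split=> //; first exact: (homo_ltn ltn_trans psiS).
move=> T e e0; have e3 : 0 < e / 3 by lra.
have b0 : 0 <= Num.max T (e / 3)^-1 by rewrite le_max invr_ge0 (ltW e3) orbT.
exists (Num.bound (Num.max T (e / 3)^-1)) => j Nj t /andP[t0 tT] /=.
have := archi_boundP b0; rewrite gt_max => /andP[hT he].
have {}Nj : (Num.bound (Num.max T (e / 3)^-1))%:R <= j.+1%:R :> R.
  by rewrite ler_nat leqW.
set q : R := j.+1%:R in Nj *.
have q0 : 0 < q by rewrite /q.
have qe : q^-1 < e / 3 by rewrite invf_plt ?posrE// (lt_le_trans he).
have tq0 : 0 <= t * q by rewrite mulr_ge0// ltW.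
have [i /andP[i1 i2]] : exists i : nat, i%:R <= t * q < i.+1%:R.
  by eexists; exact: truncn_itv.
have ib : (i < (j.+1 * j.+1).+1)%N.
  rewrite ltnS -(ler_nat R) natrM -/q (le_trans i1)// ler_pM2r//.
  by rewrite (le_trans tT)// ltW// (lt_le_trans hT).
have s1 : grid j i <= t by rewrite /grid -/q ler_pdivrMr.
have s2 : t - grid j i <= q^-1.
  rewrite lerBlDr /grid -/q -{1}(mul1r q^-1) -mulrDl ler_pdivlMr// ltW//.
  by rewrite (lt_le_trans i2)// -natr1 addrC.
have s0 := grid0 j i.
have h := psi_grid j i ib; rewrite -/q in h.
have := dtri (cX (psi j) t t0) (cX (psi j) _ s0) (gX t t0).
have := dtri (cX (psi j) _ s0) (gX _ s0) (gX t t0).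
have := clip (psi j) _ _ s0 s1; have := glip _ _ s0 s1.
rewrite (dC (cX (psi j) t t0) (cX (psi j) _ s0)).
by move: h s2 qe; move: (grid j i) (q^-1) => u p; clear; lra.
Qed.

Lemma limit_geodesic_ray o c g : g 0 = o -> (forall t, 0 <= t -> X (g t)) ->
  (forall m, lipschitz_from o (c m)) -> cvg_on_compacts d c g ->
  (forall T, exists N, forall m, (N <= m)%N -> forall s t,
    0 <= s -> s <= T -> 0 <= t -> t <= T -> d (c m s) (c m t) = `|s - t|) ->
  geodesic_ray X d o g.
Proof.
move=> g0 gX cl cg ciso; split => // s t s0 t0.
have cX m u : 0 <= u -> X (c m u) by move=> u0; case: (cl m) => _ + _; apply.
pose T := Num.max s t.
have [sT tT] : s <= T /\ t <= T by rewrite !le_max !lexx orbT.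
have [N hN] := ciso T.
have close e : 0 < e -> exists m, [/\ d (c m s) (g s) < e, d (c m t) (g t) < e &
    d (c m s) (c m t) = `|s - t|].
  move=> e0; have [M hM] := cg T e e0.
  exists (maxn M N); split; [apply: hM|apply: hM|apply: hN] => //;
    by rewrite ?leq_maxl ?leq_maxr ?s0 ?t0.
have [Xs Xt] := (gX s s0, gX t t0).
apply/le_anti/andP; split; apply/ler_addgt0Pr => e e0; have e2 : 0 < e / 2 by lra.
  have [m [h1 h2 <-]] := close _ e2.
  have [Cs Ct] := (cX m s s0, cX m t t0).
  have := dtri Xs Cs Xt; have := dtri Cs Ct Xt; rewrite (dC Xs Cs); lra.
have [m [h1 h2 <-]] := close _ e2.
have [Cs Ct] := (cX m s s0, cX m t t0).
have := dtri Cs Xs Ct; have := dtri Xs Xt Ct; rewrite (dC Xt Ct); lra.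
Qed.

Lemma gromov_cvg_limit o (u : nat -> gromov_closure X d o) l c g :
  (forall m, generalized_ray (u m) (c m)) -> generalized_ray l g ->
  cvg_on_compacts d c g -> gromov_cvg u l.
Proof.
move=> cu gl cg; exists c => // phi phiS; exists id => //; exists g => //.
move=> T e /(cg T)[N hN]; exists N => m Nm; apply: hN; apply: leq_trans Nm _.
exact: strictly_increasing_ge.
Qed.

(** Otherwise a subsequence would stay in the complement of an open
    neighbourhood, which is closed under this convergence. *)
Lemma gromov_cvg_nbhs o (u : nat -> gromov_closure X d o) l A :
  gromov_cvg u l -> nbhs l A -> exists N, forall m, (N <= m)%N -> A (u m).
Proof.
move=> ul; rewrite nbhsE => -[B [Bo Bl] BA].
apply: contrapT => /forallNP h.
have [|phi phiS phiB] := @frequently_subseq (fun m => ~ B (u m)).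
  move=> N; have /existsNP[m /not_implyP[Nm nA]] := h N.
  by exists m => // /BA.
exact: (Bo (u \o phi) l phiB (gromov_cvg_subseq phiS ul)).
Qed.

(** Closed sets of the compactification are defined by sequences, so preimages
    of closed sets can be tested on them. *)
Lemma gromov_continuous o (Y : topologicalType) (f : gromov_closure X d o -> Y) :
  (forall F u l, closed F -> (forall m, F (f (u m))) -> gromov_cvg u l -> F (f l)) ->
  continuous f.
Proof.
move=> h; apply/continuous_closedP => F cF; rewrite -openC.
suff : gromov_open (~` (f @^-1` F)) by [].
by rewrite /gromov_open setCK => u l; exact: h.
Qed.

Definition ray_point o g (gray : geodesic_ray X d o g) : gromov_closure X d o :=
  Ideal (exist _ (ray_class X d o g) (ex_intro2 _ _ g gray erefl)).

(** Geodesics from [o] to the points of the sequence subconverge, and the limit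
    is a ray because their lengths tend to infinity. *)
Lemma escaping_subseq o (x : nat -> {x | X x}) :
  proper_on -> geodesic_on -> X o ->
  (forall M, exists N, forall m, (N <= m)%N -> M < d o (sval (x m))) ->
  exists psi c g, [/\ strictly_increasing psi, geodesic_ray X d o g,
    forall m, generalized_ray (Inner d o (x (psi m))) (c m) &
    cvg_on_compacts d c g].
Proof.
move=> dproper dgeo Xo xoo.
have /choice[c0 c0P] m : exists g,
    geodesic_from_to X d o (sval (x m)) (d o (sval (x m))) g /\
    forall t, d o (sval (x m)) <= t -> g t = sval (x m).
  have [g hg] := dgeo _ _ Xo (svalP (x m)).
  by exists (stopped g (d o (sval (x m)))); exact: stopped_geodesic.
have cl m : lipschitz_from o (c0 m).
  by have [h1 h2] := c0P m; exact: geodesic_from_to_lipschitz h1 h2.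
have [psi [g [psiS g0 gX cg]]] := arzela_ascoli dproper Xo cl.
exists psi, (c0 \o psi), g; split => //; last first.
  by move=> m; exists (d o (sval (x (psi m)))); exact: c0P.
apply: limit_geodesic_ray g0 gX _ cg _ => [m|T]; first exact: cl.
have [N hN] := xoo T; exists N => m Nm s t s0 sT t0 tT.
have /ltW TT := hN (psi m) (leq_trans Nm (strictly_increasing_ge m psiS)).
have [[[_ _ cd] _ _] _] := c0P (psi m).
by apply: cd; rewrite ?s0 ?t0 (le_trans _ TT).
Qed.

(** The only use of hyperbolicity: in a thin triangle with apex [o] whose
    opposite side is far from [o], a point of one of the other two sides is close
    to a point of the last one, and comparing distances to [o] shows that the two
    points have almost the same parameter. *)
Lemma far_geodesics_fellow_travel delta o c c' f (T T' L : nat -> R) g h :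
  0 <= delta -> thin_triangles X d delta -> X o ->
  (forall m, geodesic_from_to X d o (c m (T m)) (T m) (c m)) ->
  (forall m, geodesic_from_to X d o (c' m (T' m)) (T' m) (c' m)) ->
  (forall m, geodesic_from_to X d (c m (T m)) (c' m (T' m)) (L m) (f m)) ->
  (forall M, exists N, forall m, (N <= m)%N ->
    forall s, 0 <= s -> s <= L m -> M < d o (f m s)) ->
  geodesic_ray X d o g -> geodesic_ray X d o h ->
  cvg_on_compacts d c g -> cvg_on_compacts d c' h ->
  equivalent_rays d g h.
Proof.
move=> delta0 thin Xo hc hc' hf far gray hray cg ch.
exists (2 * delta) => _ [t /= t0 <-].
have [g0 gX _] := gray; have [h0 hX _] := hray.
apply/ler_addgt0Pr => e e0; have e2 : 0 < e / 2 by lra.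
have [N1 h1] := cg t _ e2; have [N2 h2] := ch t _ e2.
have [N3 h3] := far (t + delta).
pose m := maxn N1 (maxn N2 N3).
have {}h1 : d (c m t) (g t) < e / 2 by apply: h1; rewrite ?leq_maxl ?t0 ?lexx.
have {}h2 : d (c' m t) (h t) < e / 2.
  by apply: h2; rewrite ?t0 ?lexx// /m maxnCA leq_maxl.
have {}h3 s : 0 <= s -> s <= L m -> t + delta < d o (f m s).
  by apply: h3; rewrite /m maxnA leq_maxr.
have [[L0 fX fd] f0 fL] := hf m.
have [[T0 cX cd] c0 _] := hc m; have [[T'0 c'X c'd] c'0 _] := hc' m.
have tT : t <= T m.
  have := h3 0 (lexx 0) L0; rewrite f0.
  by rewrite (geodesic_from_to_dist (hc m) T0 (lexx _)); lra.
have tT' : t <= T' m.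
  have := h3 _ L0 (lexx _); rewrite fL.
  by rewrite (geodesic_from_to_dist (hc' m) T'0 (lexx _)); lra.
have Xct : X (c m t) by apply: cX; rewrite t0.
have Xc't : X (c' m t) by apply: c'X; rewrite t0.
have dct := geodesic_from_to_dist (hc m) t0 tT.
have [|q [+ dq]] := thin _ _ _ _ _ _ _ _ _ (hc m) (hf m) (geodesic_rev (hc' m)) (c m t).
  by exists t => //=; rewrite in_itv/= t0.
have := dtri (gX t t0) Xct (hX t t0); have := dtri Xct Xc't (hX t t0).
rewrite (dC (gX t t0) Xct) => tr1 tr2 side.
suff : d (c m t) (c' m t) <= 2 * delta by lra.
case: side => -[s /=]; rewrite in_itv/= => /andP[s0 sL] qE.
  have Xq : X q by rewrite -qE; apply: fX; rewrite s0.
  by have := h3 s s0 sL; rewrite qE; have := dtri Xo Xct Xq; lra.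
pose r := T' m - s; have r0 : 0 <= r by rewrite /r; lra.
have rT : r <= T' m by rewrite /r; lra.
have Xq : X q by rewrite -qE; apply: c'X; rewrite -/r r0.
have dqr : d o q = r by rewrite -qE (geodesic_from_to_dist (hc' m)).
have dtr : d q (c' m t) = `|r - t|.
  by rewrite -qE c'd// ?t0// -/r ?r0.
have := dtri Xo Xct Xq; have := dtri Xo Xq Xct; have := dtri Xct Xq Xc't.
rewrite dct dqr (dC Xq Xct) dtr.
by have [|] := leP 0 (r - t) => ?; [rewrite ger0_norm//|rewrite ltr0_norm//]; lra.
Qed.

End GromovCompactification.

(** * Landing of rays in visibility domains *)

Section Visibility.
Context {R : realType} {n : nat}.
Variables (Omega : set 'rV[R]_n) (o : 'rV[R]_n).
Hypothesis Omega_dom : domain Omega.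
Hypothesis Omega_bdd : bounded_set Omega.
Hypothesis Oo : Omega o.
Implicit Types (x y z p q : 'rV[R]_n) (s t e r M T : R) (g h : R -> 'rV[R]_n).

Notation k := (qh_dist Omega).

Lemma qh_metric_on : metric_on Omega k.
Proof.
split.
- by move=> x; exact: qh_distxx.
- by move=> x y; exact: qh_distC.
- by move=> y x z; exact: qh_dist_triangle.
Qed.

Lemma qh_proper_on : proper_on Omega k.
Proof. by move=> G o' r u GU; exact: qh_proper. Qed.

Lemma qh_geodesic_on : geodesic_on Omega k.
Proof. by move=> x y; exact: qh_geodesic_exists. Qed.

Lemma closed_edist (F : set 'rV[R]_n) p : closed F ->
  (forall e, 0 < e -> exists2 y, F y & edist y p < e) -> F p.
Proof.
move=> cF hF; apply: cF => A /nbhs_edistP[e e0 eA].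
by have [y Fy yp] := hF e e0; exists y; split => //; exact: eA.
Qed.

Lemma bounded_ultralimit (G : set_system nat) (u : nat -> 'rV[R]_n) :
  UltraFilter G -> (forall m, Omega (u m)) ->
  exists p, forall e, 0 < e -> G [set m | edist (u m) p < e].
Proof.
move=> GU Ou; have [M M0 hM] := bounded_domain_norm Omega_bdd.
have cbox : compact [set v : 'rV[R]_n | forall i, v ord0 i \in `[- (n%:R * M), n%:R * M]].
  apply: (@rV_compact _ _ (fun=> `[- (n%:R * M), n%:R * M]%classic)) => _.
  exact: segment_compact.
have [|p _ hp] := compact_ultralimit (u := u) GU cbox.
  apply: filterS filterT => m _ i; rewrite in_itv/= -ler_norml.
  have := coord_le_edist (u m) 0 i; rewrite mxE subr0 => /le_trans; apply.
  apply: (le_trans (edist_le_norm _ _)); rewrite subr0.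
  by rewrite ler_wpM2l// hM.
exists p => e e0; apply: (hp [set y | edist y p < e]).
by apply/nbhs_edistP; exists e.
Qed.

Lemma compact_qh_bounded (K : set 'rV[R]_n) : compact K -> K `<=` Omega ->
  exists M, forall x, K x -> k o x <= M.
Proof.
move=> cK KO; apply: contrapT => /forallNP h.
have /choice[u hu] (m : nat) : exists x, K x /\ m%:R < k o x.
  have /existsNP[x /not_implyP[Kx /negP]] := h m%:R.
  by rewrite -ltNge => kx; exists x.
have [G [GU Gfree]] := free_ultrafilter.
have GK : G [set m | K (u m)] by apply: filterS filterT => m _; exact: (hu m).1.
have [p Kp hp] := compact_ultralimit GU cK GK.
have Op := KO p Kp.
have [d d0 hd] := qh_dist_near Omega_dom Op (@ltr01 R).
have Gd : G [set m | edist (u m) p < d].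
  by apply: (hp [set y | edist y p < d]); apply/nbhs_edistP; exists d.
have [m [/= md mB]] :=
  filter_ex (filterI Gd (Gfree (Num.bound (k o p + 1)))).
have [|Ou kpu] := hd (u m); first by rewrite edistC.
have := qh_dist_triangle Omega_dom Oo Op Ou.
have kp0 : 0 <= k o p + 1 by rewrite addr_ge0// qh_dist_ge0.
have := archi_boundP kp0; have := (hu m).2.
have : (Num.bound (k o p + 1))%:R <= m%:R :> R by rewrite ler_nat.
lra.
Qed.

(** A limit point in the domain would bound the distances to [o]. *)
Lemma escaping_boundary (G : set_system nat) (u : nat -> 'rV[R]_n) p :
  UltraFilter G -> (forall m, Omega (u m)) ->
  (forall e, 0 < e -> G [set m | edist (u m) p < e]) ->
  (forall M, G [set m | M < k o (u m)]) -> boundary Omega p.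
Proof.
move=> GU Ou up uoo; apply/(boundaryP Omega_dom); split.
  by move=> e /up/filter_ex[m um]; exists (u m).
move=> Op; have [d d0 hd] := qh_dist_near Omega_dom Op (@ltr01 R).
have [m [/= md mM]] := filter_ex (filterI (up d d0) (uoo (k o p + 1))).
have [|_ kpu] := hd (u m); first by rewrite edistC.
by have := qh_dist_triangle Omega_dom Oo Op (Ou m); lra.
Qed.

(** The compact set given by visibility lies in a ball around [o], which the
    escaping geodesics miss.  This is the only use of visibility. *)
Lemma visibility_no_escape p q : qh_visibility_domain Omega ->
  boundary Omega p -> boundary Omega q ->
  (forall M e, 0 < e -> exists T g,
    [/\ geodesic Omega k T g, edist (g 0) p < e, edist (g T) q < e &
        forall s, 0 <= s -> s <= T -> M < k o (g s)]) ->
  p = q.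
Proof.
move=> vis bp bq esc; apply: contrapT => pq.
have [U [W [K [/nbhs_edistP[e1 e10 pU] /nbhs_edistP[e2 e20 qW] _ [cK KO] hK]]]] :=
  vis p q bp bq pq.
have [M hM] := compact_qh_bounded cK KO.
have e0 : 0 < Num.min e1 e2 by rewrite lt_min e10.
have [T [g [gg]]] := esc M _ e0; rewrite !lt_min => /andP[gp _] /andP[_ gq] far.
have [_ [[s sT <-] /hM kM]] := hK T g gg (pU _ gp) (qW _ gq).
move: sT; rewrite /= in_itv/= => /andP[s0 sT].
by have := far s s0 sT; rewrite ltNge kM.
Qed.

Definition lands g p : Prop :=
  forall e, 0 < e -> exists2 T, 0 <= T & forall t, T <= t -> edist (g t) p < e.

Lemma qh_ray_dist g t : geodesic_ray Omega k o g -> 0 <= t -> k o (g t) = t.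
Proof.
by move=> [g0 _ gd] t0; rewrite -{1}g0 gd// sub0r normrN ger0_norm.
Qed.

(** Two distinct cluster points at infinity would be joined by arbitrarily far
    subsegments of the ray. *)
Lemma ray_lands g : qh_visibility_domain Omega -> geodesic_ray Omega k o g ->
  exists2 p, boundary Omega p & lands g p.
Proof.
move=> vis gray; have [g0 gO gd] := gray.
have [G [GU Gfree]] := free_ultrafilter.
have far (v : nat -> R) : (forall m, m%:R <= v m) ->
    forall M, G [set m | M < k o (g (v m))].
  move=> hv M; have [N hN] := nat_above M; apply: filterS (Gfree N) => m /= Nm.
  have v0 : 0 <= v m by rewrite (le_trans _ (hv m)).
  by rewrite qh_ray_dist//; apply: lt_le_trans (hv m); exact: hN.
have lim (v : nat -> R) : (forall m, m%:R <= v m) ->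
    exists2 p, boundary Omega p & forall e, 0 < e -> G [set m | edist (g (v m)) p < e].
  move=> hv.
  have Ov m : Omega (g (v m)) by apply: gO; rewrite (le_trans _ (hv m)).
  have [p hp] := bounded_ultralimit GU Ov.
  by exists p => //; apply: (escaping_boundary GU Ov hp); exact: far.
have [p bp hp] := lim _ (fun m => lexx m%:R).
exists p => //; apply: contrapT => /existsNP[e /not_implyP[e0 /forall2NP nl]].
(* Arbitrarily late times [v m] at which the ray is away from [p]. *)
have /choice[v hv] (m : nat) : exists t, m%:R <= t /\ e <= edist (g t) p.
  have [/(_ (ler0n R m))//|/existsNP[t /not_implyP[mt /negP]]] := nl m%:R.
  by rewrite -leNgt => te; exists t.
have [q bq hq] := lim v (fun m => (hv m).1).
have pq : p = q.
  apply: visibility_no_escape => // M e' e'0.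
  have [m [/= h1 h2]] := filter_ex (filterI (hp e' e'0) (far _ (fun m => lexx m%:R) M)).
  have [N h3 Nv] : exists2 N, edist (g (v N)) q < e' & m%:R <= v N.
    have [N [/= h3 mN]] := filter_ex (filterI (hq e' e'0) (Gfree m)).
    by exists N => //; apply: le_trans (hv N).1; rewrite ler_nat.
  exists (v N - m%:R), (fun t => g (m%:R + t)); split.
  - apply: (geodesic_sub (T := v N)) => //.
    by apply: geodesic_ray_geodesic gray _; rewrite (le_trans _ Nv).
  - by rewrite addr0.
  - by rewrite addrC subrK.
  - move=> s s0 _; rewrite qh_ray_dist// ?addr_ge0//.
    by move: h2; rewrite qh_ray_dist//; lra.
have [m /= h] := filter_ex (hq e e0).
by have := (hv m).2; rewrite pq leNgt h.
Qed.

(** Geodesics between points of the two rays at the same time have bounded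
    length, so they move to infinity with the rays. *)
Lemma equivalent_rays_land g h p q : qh_visibility_domain Omega ->
  geodesic_ray Omega k o g -> geodesic_ray Omega k o h -> equivalent_rays k g h ->
  boundary Omega p -> boundary Omega q -> lands g p -> lands h q -> p = q.
Proof.
move=> vis gray hray [B hB] bp bq gp hq.
apply: visibility_no_escape => // M e e0.
have [T1 T10 h1] := gp e e0; have [T2 T20 h2] := hq e e0.
pose t := Num.max (Num.max T1 T2) (M + B + 1).
have [t1 t2 t3] : [/\ T1 <= t, T2 <= t & M + B + 1 <= t].
  by split; rewrite /t !le_max lexx ?orbT.
have t0 : 0 <= t := le_trans T10 t1.
have [_ gO _] := gray; have [_ hO _] := hray.
have [f ff] := qh_geodesic_exists Omega_dom Omega_bdd (gO t t0) (hO t t0).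
have [fgeo f0 fT] := ff; have [_ fO _] := fgeo.
exists (k (g t) (h t)), f; split => //; [by rewrite f0; exact: h1|by rewrite fT; exact: h2|].
move=> s s0 sT.
have Ofs : Omega (f s) by apply: fO; rewrite s0.
have sB : k (g t) (h t) <= B by apply: hB; exists t.
have := geodesic_from_to_dist ff s0 sT.
have := qh_dist_triangle Omega_dom Oo Ofs (gO t t0).
rewrite qh_ray_dist// (qh_distC Omega_dom Ofs (gO t t0)); lra.
Qed.

Notation closureG := (gromov_closure Omega k o).

(** At an ideal point all its rays are constrained, and not only a chosen one:
    the rays produced by compactness arguments are arbitrary representatives. *)
Definition extension_value (zeta : closureG) p : Prop :=
  match zeta with
  | Inner x => p = sval x
  | Ideal C => boundary Omega p /\ forall g, sval C g -> lands g p
  end.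

Lemma extension_exists : qh_visibility_domain Omega ->
  exists f : closureG -> 'rV[R]_n, forall zeta, extension_value zeta (f zeta).
Proof.
move=> vis; suff /choice[f hf] zeta : exists p, extension_value zeta p by exists f.
case: zeta => [x|[C CP]] /=; first by exists (sval x).
have [g gray CE] := CP.
have [p bp gp] := ray_lands vis gray.
exists p; split => // h; rewrite CE => -[hray gh].
have [q bq hq] := ray_lands vis hray.
by rewrite (equivalent_rays_land vis gray hray gh bp bq gp hq).
Qed.

(** Treats segments and rays alike: a ray is cut so late that its end is close
    to its landing point, and a segment is taken whole. *)
Lemma generalized_ray_end (f : closureG -> 'rV[R]_n) zeta g (m : nat) e :
  extension_value zeta (f zeta) -> generalized_ray zeta g -> 0 < e ->
  exists T, [/\ 0 <= T, geodesic Omega k T g, edist (g T) (f zeta) < e &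
    m%:R <= T \/ forall t, T <= t -> g t = g T].
Proof.
case: zeta => [x|C] /= fz gz e0.
  have [T [[gT g0 gx] gc]] := gz.
  have T0 : 0 <= T by case: gT.
  exists T; split => //; first by rewrite fz gx edistxx.
  by right => t Tt; rewrite gx gc.
have gray := ideal_ray gz.
have [T T0 hT] := fz.2 g gz e e0.
exists (Num.max T m%:R); split.
- by rewrite le_max T0.
- by apply: geodesic_ray_geodesic gray _; rewrite le_max T0.
- by apply: hT; rewrite le_max lexx.
- by left; rewrite le_max lexx orbT.
Qed.

(** For an ideal limit, a sequence of values with a different limit would give
    escaping geodesics: the final pieces of the rays converging to a ray of the
    limit point. *)
Lemma extension_closed (f : closureG -> 'rV[R]_n) F u0 l :
  qh_visibility_domain Omega -> (forall zeta, extension_value zeta (f zeta)) ->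
  closed F -> (forall m, F (f (u0 m))) -> gromov_cvg u0 l -> F (f l).
Proof.
move=> vis fP cF Fu0 [c0 cu0 cP].
have [psi psiS [g gl cg0]] := cP id (fun i j ij => ij).
have cg : cvg_on_compacts k (c0 \o psi) g by exact: cg0.
have Fu m : F (f ((u0 \o psi) m)) by exact: Fu0.
have cu m : generalized_ray ((u0 \o psi) m) ((c0 \o psi) m) by exact: cu0.
move: (u0 \o psi) (c0 \o psi) Fu cu cg => u c Fu cu cg {Fu0 cu0 cP cg0}.
have [D D0 hD] := edist_le_qh_dist Omega_dom Omega_bdd.
have cl m := generalized_ray_lipschitz qh_metric_on (cu m).
have cO m t : 0 <= t -> Omega (c m t) by move=> t0; case: (cl m) => _ + _; apply.
have [g0 gO glip] := generalized_ray_lipschitz qh_metric_on gl.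
have /choice[T hT] (m : nat) : exists T, [/\ 0 <= T, geodesic Omega k T (c m),
    edist (c m T) (f (u m)) < m.+1%:R^-1 &
    m%:R <= T \/ forall t, T <= t -> c m t = c m T].
  by apply: generalized_ray_end => //; rewrite invr_gt0.
have kT m t : 0 <= t -> t <= T m -> k o (c m t) = t.
  move=> t0 tT; have [T0 gT _ _] := hT m; have [cm0 _ _] := cl m.
  apply: (@geodesic_from_to_dist _ _ Omega k o (c m (T m)) (T m)) => //.
case: l gl => [x|C] /=; last first.
  move=> gC; have gray := ideal_ray gC.
  have [bp /(_ g gC) gp] := fP (Ideal C).
  (* A segment which ended before time [B] would be constant on [B, B + 1],
     where the limit ray has length 1. *)
  have Toff B : 0 <= B -> exists N, forall m, (N <= m)%N -> B <= T m.
    move=> B0; have half0 : 0 < 2^-1 :> R by rewrite invr_gt0.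
    have [N hN] := cg (B + 1) _ half0.
    exists (maxn N (Num.bound B)) => m; rewrite geq_max => /andP[Nm Bm].
    have [T0 _ _ [mT|cst]] := hT m.
      apply: le_trans mT; apply: le_trans (ltW (archi_boundP B0)) _.
      by rewrite ler_nat.
    rewrite leNgt; apply/negP => TB.
    have B10 : 0 <= B + 1 by lra.
    have hB := hN m Nm B; have hB1 := hN m Nm (B + 1).
    have {}hB : k (c m B) (g B) < 2^-1 by apply: hB; lra.
    have {}hB1 : k (c m (B + 1)) (g (B + 1)) < 2^-1 by apply: hB1; lra.
    have cE : c m B = c m (B + 1) by rewrite !cst//; lra.
    have [_ _ gd] := gray.
    have := gd B (B + 1) B0 B10; rewrite distrC addrAC subrr add0r normr1.
    have := qh_dist_triangle Omega_dom (gO B B0) (cO m B B0) (gO _ B10).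
    rewrite (qh_distC Omega_dom (gO B B0) (cO m B B0)).
    by rewrite -cE in hB1; lra.
  have [G [GU Gfree]] := free_ultrafilter.
  pose y m := c m (T m).
  have Oy m : Omega (y m) by apply: cO; case: (hT m).
  have [q hq] := bounded_ultralimit GU Oy.
  have bq : boundary Omega q.
    apply: (escaping_boundary GU Oy hq) => M.
    have [|N hN] := Toff (Num.max 0 (M + 1)); first by rewrite le_max lexx.
    apply: filterS (Gfree N) => m /= /hN; rewrite ge_max => /andP[T0 MT].
    by rewrite kT//; lra.
  suff -> : f (Ideal C) = q.
    apply: closed_edist cF _ => e e0; have e2 : 0 < e / 2 by lra.
    have [N hN] := inv_succ_small e2.
    have [m [/= h1 /hN h2]] := filter_ex (filterI (hq _ e2) (Gfree N)).
    exists (f (u m)) => //; have [_ _ h3 _] := hT m.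
    have := edist_triangle (y m) (f (u m)) q; rewrite (edistC _ (y m)) /y.
    by have := lt_trans h3 h2; rewrite /y in h1; move: h1; clear; lra.
  apply: visibility_no_escape => // M e e0.
  have e2 : 0 < e / 2 by lra.
  have [T0 T00 hT0] := gp _ e2.
  pose t := Num.max T0 (M + 1).
  have [t1 t2] : T0 <= t /\ M + 1 <= t by rewrite /t !le_max !lexx orbT.
  have t0 : 0 <= t := le_trans T00 t1.
  have eD : 0 < e / 2 / D by rewrite divr_gt0.
  have [N1 h1] := cg t _ eD; have [N2 h2] := Toff t t0.
  have [m [/= h3]] := filter_ex (filterI (hq e e0) (Gfree (maxn N1 N2))).
  rewrite geq_max => /andP[/h1/(_ t) h4 /h2 tT].
  have [T0' gT _ _] := hT m.
  exists (T m - t), (fun s => c m (t + s)); split.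
  - exact: geodesic_sub gT t0 tT (lexx _).
  - rewrite addr0; have {}h4 : k (c m t) (g t) < e / 2 / D by apply: h4; rewrite t0 lexx.
    have := edist_triangle (g t) (c m t) (f (Ideal C)).
    have := hT0 t t1; have := hD _ _ (cO m t t0) (gO t t0).
    by move: h4; rewrite ltr_pdivlMr// mulrC => ? ? ? ?; lra.
  - by rewrite addrC subrK.
  - by move=> s s0 sT; rewrite kT; lra.
move=> [S [gS gc]].
have S0 : 0 <= S by case: gS => -[].
have -> : f (Inner k o x) = sval x := fP (Inner k o x).
apply: closed_edist cF _ => e e0.
pose e' := Num.min (e / D) 2^-1.
have e'0 : 0 < e' by rewrite lt_min divr_gt0//= invr_gt0.
have [e'1 e'2] : e' <= e / D /\ e' <= 2^-1 by rewrite /e' !ge_min !lexx orbT.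
have [N /(_ N (leqnn N)) hN] := cg (S + 1) e' e'0.
have S10 : 0 <= S + 1 by lra.
have hS : k (c N S) (sval x) < e' by rewrite -(gc S)//; apply: hN; lra.
have hS1 : k (c N (S + 1)) (sval x) < e'.
  by rewrite -(gc (S + 1)); [apply: hN; lra|lra].
have Ox := svalP x.
exists (f (u N)) => //.
(* A geodesic defined up to [S + 1] would move by 1 after time [S], when the
   limit has stopped at [x]. *)
have short : forall T', geodesic Omega k T' (c N) -> T' < S + 1.
  move=> T' [_ _ cd]; rewrite ltNge; apply/negP => ST'.
  have := cd S (S + 1); rewrite distrC addrAC subrr add0r normr1.
  have := qh_dist_triangle Omega_dom (cO N S S0) Ox (cO N _ S10).
  rewrite (qh_distC Omega_dom Ox (cO N _ S10)) => tr h.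
  by have := h _ _; rewrite S0 S10 ST' /= => /(_ _ isT); lra.
have := cu N; have := fP (u N); case: (u N) => [y|C] /= fy.
  move=> [T' [[gT' _ cT'] cc]].
  have TS := short T' gT'.
  rewrite fy -(cc (S + 1)); last lra.
  apply: (le_lt_trans (hD _ _ (cO N _ S10) Ox)).
  by rewrite mulrC -ltr_pdivlMr//; lra.
move=> CN; have gray := ideal_ray CN.
by have := short (S + 1) (geodesic_ray_geodesic gray S10); lra.
Qed.

End Visibility.

(** * Visibility and extensions of the identity *)

Section Equivalence.
Context {R : realType} {n : nat}.
Variables (Omega : set 'rV[R]_n) (o : 'rV[R]_n).
Hypothesis Omega_dom : domain Omega.
Hypothesis Omega_bdd : bounded_set Omega.
Hypothesis Oo : Omega o.
Implicit Types (x y z p q : 'rV[R]_n) (s t e r M T : R) (g h : R -> 'rV[R]_n).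

Notation k := (qh_dist Omega).
Notation closureG := (gromov_closure Omega k o).

Let kmetric := qh_metric_on Omega_dom.
Let kproper := qh_proper_on Omega_dom Omega_bdd.
Let kgeodesic := qh_geodesic_on Omega_dom Omega_bdd.

Lemma extension_at_limit (Phi : closureG -> 'rV[R]_n)
    (x : nat -> {x | Omega x}) l p :
  continuous Phi -> (forall x : {x | Omega x}, Phi (Inner k o x) = sval x) ->
  gromov_cvg (fun m => Inner k o (x m)) l ->
  (forall e, 0 < e -> exists N, forall m, (N <= m)%N -> edist (sval (x m)) p < e) ->
  Phi l = p.
Proof.
move=> cPhi PhiE xl xp.
apply: edist_eq0; apply/le_anti; rewrite edist_ge0 andbT.
apply/ler_addgt0Pr => e e0; have e2 : 0 < e / 2 by lra.
have nb : nbhs l (Phi @^-1` [set y | edist y (Phi l) < e / 2]).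
  by apply: cPhi; apply/nbhs_edistP; exists (e / 2).
have [N1 h1] := gromov_cvg_nbhs xl nb; have [N2 h2] := xp _ e2.
have {}h1 : edist (sval (x (maxn N1 N2))) (Phi l) < e / 2.
  by rewrite -(PhiE (x _)); apply: h1; exact: leq_maxl.
have {}h2 := h2 _ (leq_maxr N1 N2).
have := edist_triangle (sval (x (maxn N1 N2))) (Phi l) p.
by rewrite (edistC (Phi l) (sval _)); lra.
Qed.

Lemma visibility_extension : qh_visibility_domain Omega ->
  exists Phi : closureG -> 'rV[R]_n, extends_identity Phi.
Proof.
move=> vis; have [Phi PhiP] := extension_exists Omega_dom Omega_bdd Oo vis.
have cPhi : continuous Phi.
  apply: gromov_continuous => F u l.
  exact: (extension_closed Omega_dom Omega_bdd Oo vis PhiP).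
have PhiE (x : {x | Omega x}) : Phi (Inner k o x) = sval x := PhiP (Inner k o x).
have Oclo : Omega `<=` closure Omega by exact: subset_closure.
exists Phi; split => //; apply/seteqP; split => [_ [zeta _ <-]|q cq].
  case: zeta => [x|C]; first by rewrite PhiE; apply: Oclo; exact: svalP.
  by have [[]] := PhiP (Ideal C).
have [Oq|nOq] := pselect (Omega q); first by exists (Inner k o (exist _ q Oq)).
(* Geodesics from [o] to a sequence tending to [q] subconverge to a ray, whose
   landing point is [q] by continuity. *)
have bq : boundary Omega q.
  by split=> // /interior_subset.
have /choice[x hx] (m : nat) : exists x : {x | Omega x}, edist (sval x) q < m.+1%:R^-1.
  have [near _] := (boundaryP Omega_dom q).1 bq.
  have [|y Oy yq] := near m.+1%:R^-1; first by rewrite invr_gt0.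
  by exists (exist _ y Oy).
have xq e : 0 < e -> exists N, forall m, (N <= m)%N -> edist (sval (x m)) q < e.
  by move=> /inv_succ_small[N hN]; exists N => m /hN; exact: lt_trans.
have xoo M : exists N, forall m, (N <= m)%N -> M < k o (sval (x m)).
  have [c c0 hc] := bdist_ge_qh_ball Omega_dom M Oo.
  have [N hN] := xq c c0; exists N => m Nm; rewrite ltNge; apply/negP => kM.
  have := hc _ (svalP (x m)) kM.
  by have := bdist_le (sval (x m)) bq; have := hN m Nm; lra.
have [psi [c [g [psiS gray hc cg]]]] :=
  escaping_subseq kmetric kproper kgeodesic Oo xoo.
exists (ray_point gray) => //.
have lim : gromov_cvg (fun m => Inner k o (x (psi m))) (ray_point gray).
  apply: gromov_cvg_limit hc _ cg; split => //.
  exists 0 => _ [t /= t0 <-]; have [_ gO _] := gray.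
  by rewrite qh_distxx//; exact: gO.
apply: (extension_at_limit cPhi PhiE lim) => e /xq[N hN]; exists N => m Nm.
exact/hN/(leq_trans Nm)/strictly_increasing_ge.
Qed.

(** If visibility fails at [p] and [q], geodesics with endpoints tending to [p]
    and [q] leave every ball.  By hyperbolicity the endpoints then tend to the
    same ideal point, whose image is both [p] and [q]. *)
Lemma extension_visibility (Phi : closureG -> 'rV[R]_n) :
  gromov_hyperbolic Omega k -> extends_identity Phi -> qh_visibility_domain Omega.
Proof.
move=> [delta [delta0 thin]] [cPhi _ PhiE] p q bp bq pq; apply: contrapT => nvis.
pose E := edist p q.
have E0 : 0 < E.
  rewrite lt_neqAle edist_ge0 andbT eq_sym; apply/eqP => h; apply: pq.
  exact: edist_eq0.
have /choice[Tg hTg] (m : nat) : exists Tg : R * (R -> 'rV[R]_n),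
    [/\ geodesic Omega k Tg.1 Tg.2, edist (Tg.2 0) p < m.+1%:R^-1,
        edist (Tg.2 Tg.1) q < m.+1%:R^-1 &
        forall s, 0 <= s -> s <= Tg.1 -> m%:R < k o (Tg.2 s)].
  apply: contrapT => nTg; apply: nvis.
  pose e := Num.min (E / 4) m.+1%:R^-1.
  have e0 : 0 < e by rewrite lt_min invr_gt0 ltr0n andbT; lra.
  have [e1 e2] : e <= E / 4 /\ e <= m.+1%:R^-1 by rewrite /e !ge_min !lexx orbT.
  exists [set y | edist y p < e], [set y | edist y q < e],
    [set y | Omega y /\ k o y <= m%:R].
  split.
  - by apply/nbhs_edistP; exists e.
  - by apply/nbhs_edistP; exists e.
  (* a quarter of the distance from [p] to [q] separates the closed balls *)
  - have clo x z : closure [set y | edist y x < e] z -> edist z x < 2 * e.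
      move=> cz; have /cz[y [yx zy]] : nbhs z [set y | edist y z < e].
        by apply/nbhs_edistP; exists e.
      rewrite /= in yx zy; have := edist_triangle y z x.
      by rewrite (edistC z y); lra.
    apply/seteqP; split => // z [/clo zp /clo zq].
    have := edist_triangle z p q; rewrite (edistC p z) -/E; lra.
  - split; last by move=> y [].
    exact: qh_ball_compact.
  - move=> T g gg /= gp gq; apply: contrapT => gK; apply: nTg.
    exists (T, g); split => //=; [exact: lt_le_trans e2|exact: lt_le_trans e2|].
    move=> s s0 sT; rewrite ltNge; apply/negP => kg; apply: gK.
    exists (g s); split; first by exists s; rewrite //= in_itv/= s0.
    by have [_ gO _] := gg; split => //; apply: gO; rewrite s0.
have Tg0 m : 0 <= (Tg m).1 by case: (hTg m) => -[].
have Og m s : 0 <= s -> s <= (Tg m).1 -> Omega ((Tg m).2 s).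
  by move=> s0 sT; case: (hTg m) => -[_ + _] _ _ _; apply; rewrite s0.
pose x m : {x | Omega x} := exist _ ((Tg m).2 0) (Og m 0 (lexx 0) (Tg0 m)).
pose y m : {x | Omega x} := exist _ ((Tg m).2 (Tg m).1) (Og m _ (Tg0 m) (lexx _)).
have xoo M : exists N, forall m, (N <= m)%N -> M < k o (sval (x m)).
  have [N hN] := nat_above M; exists N => m /hN /lt_trans; apply.
  by case: (hTg m) => _ _ _; apply.
have [psi [c [g [psiS gray cx cg]]]] :=
  escaping_subseq kmetric kproper kgeodesic Oo xoo.
have yoo M : exists N, forall m, (N <= m)%N -> M < k o (sval (y (psi m))).
  have [N hN] := nat_above M; exists N => m Nm.
  have /lt_trans := hN _ (leq_trans Nm (strictly_increasing_ge m psiS)); apply.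
  by case: (hTg (psi m)) => _ _ _; apply.
have [psi' [c' [h [psi'S hray c'y ch]]]] :=
  escaping_subseq kmetric kproper kgeodesic Oo yoo.
pose i m := psi (psi' m).
have i_ge m : (m <= i m)%N.
  apply: leq_trans (strictly_increasing_ge _ psi'S) _.
  exact: strictly_increasing_ge.
have {}cx m : generalized_ray (Inner k o (x (i m))) ((c \o psi') m) by exact: cx.
have {}cg : cvg_on_compacts k (c \o psi') g.
  move=> T e /(cg T)[N hN]; exists N => m Nm; apply: hN.
  exact: leq_trans Nm (strictly_increasing_ge _ psi'S).
have /choice[T hT] m := cx m; have /choice[T' hT'] m := c'y m.
have geo (z : nat -> {x | Omega x}) f (S : nat -> R) :
    (forall m, geodesic_from_to Omega k o (sval (z m)) (S m) (f m) /\
      (forall t, S m <= t -> f m t = sval (z m))) ->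
    forall m, f m (S m) = sval (z m) /\
      geodesic_from_to Omega k o (f m (S m)) (S m) (f m).
  by move=> hf m; have [[fgeo f0 fS] _] := hf m.
have gh : equivalent_rays k g h.
  apply: (far_geodesics_fellow_travel kmetric delta0 thin Oo
    (c := c \o psi') (c' := c') (f := fun m => (Tg (i m)).2)
    (T := T) (T' := T') (L := fun m => (Tg (i m)).1)) => //.
  - by move=> m; have [] := geo _ _ _ hT m.
  - by move=> m; have [] := geo _ _ _ hT' m.
  - move=> m; have [-> _] := geo _ _ _ hT m; have [-> _] := geo _ _ _ hT' m.
    by case: (hTg (i m)).
  - move=> M; have [N hN] := nat_above M; exists N => m Nm s s0 sT.
    have /lt_trans := hN _ (leq_trans Nm (i_ge m)); apply.
    by case: (hTg (i m)) => _ _ _; apply.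
have gg : equivalent_rays k g g.
  exists 0 => _ [t /= t0 <-]; have [_ gO _] := gray.
  by rewrite qh_distxx//; exact: gO.
have xl : gromov_cvg (fun m => Inner k o (x (i m))) (ray_point gray).
  exact: gromov_cvg_limit cx _ cg.
have yl : gromov_cvg (fun m => Inner k o (y (i m))) (ray_point gray).
  exact: gromov_cvg_limit c'y _ ch.
apply: pq.
rewrite -(extension_at_limit cPhi PhiE xl (p := p)); last first.
  move=> e /inv_succ_small[N hN]; exists N => m Nm.
  have /hN := leq_trans Nm (i_ge m); apply: lt_trans.
  by case: (hTg (i m)).
apply: (extension_at_limit cPhi PhiE yl).
move=> e /inv_succ_small[N hN]; exists N => m Nm.
have /hN := leq_trans Nm (i_ge m); apply: lt_trans.
by case: (hTg (i m)).
Qed.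

End Equivalence.

Theorem theorem2p2 (R : realType) (n : nat) (Omega : set 'rV[R]_n)
    (o : 'rV[R]_n) :
  domain Omega -> bounded_set Omega -> Omega o ->
  gromov_hyperbolic Omega (qh_dist Omega) ->
  qh_visibility_domain Omega <->
  exists Phi : gromov_closure Omega (qh_dist Omega) o -> 'rV[R]_n,
    extends_identity Phi.
Proof.
move=> Odom Obdd Oo hyp; split; first exact: visibility_extension.
by move=> [Phi]; exact: extension_visibility.
Qed.
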